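(* Let $G\le\mathrm{O}(d)$ have closed orbits. The following are equivalent: (a) the max filtering map $K([x],[y]):=\langle\!\langle[x],[y]\rangle\!\rangle$ is a positive definite kernel on $\mathbb{R}^d/G$; (b) $G$ is polar with a section $\Sigma$ such that $\mathbb{R}^d/G$ is isometric to $\Sigma/W(\Sigma,G)$, and furthermore $W(\Sigma,G)$ is a finite reflection group (acting on $\Sigma$).
   Context: For $x\in\mathbb{R}^d$, $[x]:=\{gx:g\in G\}$; $\mathbb{R}^d/G$ carries the quotient metric $d([x],[y]):=\inf_{p\in[x],q\in[y]}\|p-q\|$, and $\langle\!\langle[x],[y]\rangle\!\rangle:=\sup_{p\in[x],q\in[y]}\langle p,q\rangle$. A positive definite kernel on a set $\mathcal{X}$ is a symmetric $K:\mathcal{X}\times\mathcal{X}\to\mathbb{R}$ with $\sum_{i,j=1}^nc_ic_jK(x_i,x_j)\ge0$ for all $n$, $x_i\in\mathcal{X}$, $c_i\in\mathbb{R}$. $G$ is polar if there is a linear subspace $\Sigma\le\mathbb{R}^d$ (a section) meeting every orbit orthogonally: $G\cdot\Sigma=\mathbb{R}^d$ and for every $x\in\Sigma$ the tangent space at $x$ of the orbit $[x]$ (a smooth submanifold) lies in $\Sigma^\perp$. $W(\Sigma,G)$ is the largest subgroup of $G$ leaving $\Sigma$ invariant, acting on $\Sigma$ by restriction; $\Sigma/W(\Sigma,G)$ carries the analogous quotient metric. A finite reflection group is a finite group of orthogonal maps generated by reflections across hyperplanes. *)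

(* Defs.v *)
From HB Require Import structures.
From mathcomp Require Import all_boot all_order all_algebra.
From mathcomp Require Import all_classical all_reals all_analysis.
Set Implicit Arguments. Unset Strict Implicit. Unset Printing Implicit Defensive.
Import Order.TTheory GRing.Theory Num.Theory.
Import numFieldNormedType.Exports.
Local Open Scope classical_set_scope.
Local Open Scope ring_scope.

Section MaxFilter.
Variables (R : realType) (d : nat).
Implicit Types (x y p q s : 'rV[R]_d) (G : set 'M[R]_d) (S : 'M[R]_d).

Definition dotp x y : R := (x *m y^T) 0 0.
Definition enorm x : R := Num.sqrt (dotp x x).

(* G is a subgroup of O(d); matrices act on row vectors by x |-> x *m g *)
Definition orthogonal_subgroup G : Prop :=
  [/\ G 1%:M,
      (forall g h, G g -> G h -> G (g *m h)),
      (forall g, G g -> G (invmx g)) &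
      (forall g, G g -> g *m g^T = 1%:M)].

Definition orbit G x : set 'rV[R]_d := [set x *m g | g in G].

Definition eclosed (A : set 'rV[R]_d) : Prop :=
  forall y, (forall e : R, 0 < e -> exists2 p, A p & enorm (p - y) < e) -> A y.

Definition closed_orbits G : Prop := forall x, eclosed (orbit G x).

Definition qdist G x y : R :=
  inf [set enorm (p - q) | p in orbit G x & q in orbit G y].

Definition maxfilt G x y : R :=
  sup [set dotp p q | p in orbit G x & q in orbit G y].

(* K is a positive definite kernel on R^d/G (classes given by representatives) *)
Definition pos_def_kernel (K : 'rV[R]_d -> 'rV[R]_d -> R) : Prop :=
  (forall x y, K x y = K y x) /\
  forall (n : nat) (xs : 'I_n -> 'rV[R]_d) (c : 'I_n -> R),
    0 <= \sum_(i < n) \sum_(j < n) c i * c j * K (xs i) (xs j).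

(* the linear subspace Sigma is the row space of S *)
Definition insub_mx S x : Prop := (x <= S)%MS.

Definition orbit_tangent G x (v : 'rV[R]_d) : Prop :=
  exists gam : R -> 'rV[R]_d,
    [/\ gam 0 = x, (forall t, orbit G x (gam t)) &
        forall i : 'I_d,
          is_derive (0 : R^o) (1 : R^o) (fun t : R^o => (gam t 0 i : R^o)) (v 0 i)].

Definition is_section G S : Prop :=
  (forall x, exists2 g, G g & exists2 s, insub_mx S s & x = s *m g) /\
  (forall s, insub_mx S s -> forall v, orbit_tangent G s v ->
     forall u, insub_mx S u -> dotp v u = 0).

Definition polar G : Prop := exists S, is_section G S.

Definition weylW G S : set 'M[R]_d :=
  [set g | G g /\ forall s, insub_mx S s -> insub_mx S (s *m g)].

Definition qdistW G S s t : R :=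
  inf [set enorm (s *m w - t *m w') | w in weylW G S & w' in weylW G S].

(* R^d/G is isometric to Sigma/W(Sigma,G): a map of classes, given by a
   representative-level map F, that is well defined, distance preserving and
   surjective *)
Definition quotients_isometric G S : Prop :=
  exists F : 'rV[R]_d -> 'rV[R]_d,
    [/\ (forall x, insub_mx S (F x)),
        (forall x y, orbit G y x ->
            exists2 w, weylW G S w & F x = F y *m w),
        (forall x y, qdistW G S (F x) (F y) = qdist G x y) &
        (forall s, insub_mx S s -> exists x, exists2 w, weylW G S w & F x = s *m w)].

Definition reflect_across (a s : 'rV[R]_d) : 'rV[R]_d :=
  s - (2 * dotp s a / dotp a a) *: a.

(* W(Sigma,G), acting on Sigma by restriction, is a finite reflection group:
   its image in the maps Sigma -> Sigma is finite and generated by reflections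
   of Sigma (across hyperplanes of Sigma) that belong to it *)
Definition restr_eq S (g h : 'M[R]_d) : Prop :=
  forall s, insub_mx S s -> s *m g = s *m h.

Definition finite_reflection_group_on G S : Prop :=
  let W := weylW G S in
  (exists ws : seq 'M[R]_d, (forall w, w \in ws -> W w) /\
      forall w, W w -> exists2 w', w' \in ws & restr_eq S w w') /\
  (exists refl : seq 'M[R]_d,
     (forall r, r \in refl -> W r /\
        exists2 a, insub_mx S a /\ a != 0 &
          forall s, insub_mx S s -> s *m r = reflect_across a s) /\
     forall w, W w -> exists rs : seq 'M[R]_d,
        (forall r, r \in rs -> r \in refl) /\
        restr_eq S w (foldr (fun r m => r *m m) 1%:M rs)).

End MaxFilter.

(* Main.v *)
From Pilot Require Import Defs.
From HB Require Import structures.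
From mathcomp Require Import all_boot all_order all_algebra.
From mathcomp Require Import all_classical all_reals all_analysis.
From mathcomp Require Import ring lra.
(* all_boot has its own [orbit]; this puts the one of [Defs] back in front. *)
Import Pilot.Defs.
Set Implicit Arguments. Unset Strict Implicit. Unset Printing Implicit Defensive.
Import Order.TTheory GRing.Theory Num.Theory.
Import numFieldNormedType.Exports.
Local Open Scope classical_set_scope.
Local Open Scope ring_scope.

(** Call x and y aligned when <x, y> is the maximum K([x], [y]).

    From (a) to (b): positive definiteness makes K(w, .) additive on aligned
    vectors, so any w can be moved by G to be aligned with all members of a
    pairwise aligned family.  Let A be a linearly independent pairwise aligned
    family of maximal size and let Sigma be its span.  The vectors aligned with
    all of A form a cone C in Sigma that meets every orbit exactly once and is
    pairwise aligned, so R^d/G is isometric to C.  For aligned x, y and h in G,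
    comparing h with its inverse gives |<xh - x, y>| <= |xh - x| |yh - y|; as h
    can be corrected by the stabiliser of s so that |h - 1| = O(|sh - s|), this
    yields <sh - s, u> = O(|sh - s|^2) for all s, u in Sigma.  Hence tangent
    vectors at s are orthogonal to Sigma and s + e u is aligned with s for small
    e, so that every s in Sigma lies in some maximal aligned cone of Sigma, which
    is the image of C under an element of W(Sigma, G).  A generic segment leaving
    C crosses its boundary in a reflection hyperplane of W.

    From (b) to (a): a finite reflection group has a closed chamber meeting each
    of its orbits once (exchange property), so Sigma/W, and with it R^d/G, embeds
    isometrically in a Euclidean space; K is the Gram kernel of this embedding
    based at the image of [0]. *)

(** * Euclidean norm and row norm of a matrix *)

Section Euclid.
Variables (R : realType) (d : nat).
Implicit Types (x y z : 'rV[R]_d) (g h : 'M[R]_d).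

Lemma dotpE x y : dotp x y = \sum_i x 0 i * y 0 i.
Proof. by rewrite /dotp mxE; apply: eq_bigr => i _; rewrite mxE. Qed.

Lemma dotpC x y : dotp x y = dotp y x.
Proof. by rewrite !dotpE; apply: eq_bigr => i _; rewrite mulrC. Qed.

Lemma dotpDl x y z : dotp (x + y) z = dotp x z + dotp y z.
Proof. by rewrite /dotp mulmxDl mxE. Qed.

Lemma dotpZl (a : R) x z : dotp (a *: x) z = a * dotp x z.
Proof. by rewrite /dotp -scalemxAl mxE. Qed.

Lemma dotpNl x z : dotp (- x) z = - dotp x z.
Proof. by rewrite /dotp mulNmx mxE. Qed.

Lemma dotpBl x y z : dotp (x - y) z = dotp x z - dotp y z.
Proof. by rewrite dotpDl dotpNl. Qed.

Lemma dotpDr x y z : dotp z (x + y) = dotp z x + dotp z y.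
Proof. by rewrite dotpC dotpDl !(dotpC z). Qed.

Lemma dotpZr (a : R) x z : dotp z (a *: x) = a * dotp z x.
Proof. by rewrite dotpC dotpZl (dotpC z). Qed.

Lemma dotpNr x z : dotp z (- x) = - dotp z x.
Proof. by rewrite dotpC dotpNl (dotpC z). Qed.

Lemma dotpBr x y z : dotp z (x - y) = dotp z x - dotp z y.
Proof. by rewrite dotpDr dotpNr. Qed.

Lemma dotp0l x : dotp 0 x = 0.
Proof. by rewrite /dotp mul0mx mxE. Qed.

Lemma dotp0r x : dotp x 0 = 0.
Proof. by rewrite dotpC dotp0l. Qed.

Lemma dotp_suml (I : Type) (s : seq I) (P : pred I) (F : I -> 'rV[R]_d) y :
  dotp (\sum_(i <- s | P i) F i) y = \sum_(i <- s | P i) dotp (F i) y.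
Proof.
apply: (big_morph (fun x => dotp x y)); last exact: dotp0l.
by move=> u v; exact: dotpDl.
Qed.

Lemma dotp_sumr (I : Type) (s : seq I) (P : pred I) (F : I -> 'rV[R]_d) y :
  dotp y (\sum_(i <- s | P i) F i) = \sum_(i <- s | P i) dotp y (F i).
Proof. by rewrite dotpC dotp_suml; apply: eq_bigr => i _; rewrite dotpC. Qed.

Lemma dotpMl x y g : dotp (x *m g) y = dotp x (y *m g^T).
Proof. by rewrite /dotp trmx_mul trmxK mulmxA. Qed.

Lemma dotp_ge0 x : 0 <= dotp x x.
Proof. by rewrite dotpE; apply: sumr_ge0 => i _; rewrite -expr2 sqr_ge0. Qed.

Lemma dotp_eq0 x : (dotp x x == 0) = (x == 0).
Proof.
apply/idP/eqP => [|->]; last by rewrite dotp0l.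
rewrite dotpE psumr_eq0 => [/allP h|i _]; last by rewrite -expr2 sqr_ge0.
apply/rowP => i; have := h i (mem_index_enum _).
by rewrite -expr2 sqrf_eq0 mxE => /eqP.
Qed.

Lemma dotp_gt0 x : (0 < dotp x x) = (x != 0).
Proof. by rewrite lt_neqAle dotp_ge0 andbT eq_sym dotp_eq0. Qed.

Lemma enorm_ge0 x : 0 <= enorm x.
Proof. exact: sqrtr_ge0. Qed.

Lemma enorm_sqr x : enorm x ^+ 2 = dotp x x.
Proof. by rewrite sqr_sqrtr ?dotp_ge0. Qed.

Lemma enorm_eq0 x : (enorm x == 0) = (x == 0).
Proof. by rewrite -dotp_eq0 -enorm_sqr sqrf_eq0. Qed.

Lemma enorm0 : enorm (0 : 'rV[R]_d) = 0.
Proof. by apply/eqP; rewrite enorm_eq0. Qed.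

Lemma enorm_gt0 x : (0 < enorm x) = (x != 0).
Proof. by rewrite lt_neqAle enorm_ge0 andbT eq_sym enorm_eq0. Qed.

Lemma enormZ (a : R) x : enorm (a *: x) = `|a| * enorm x.
Proof.
by rewrite /enorm dotpZl dotpZr mulrA -expr2 sqrtrM ?sqr_ge0 // sqrtr_sqr.
Qed.

Lemma enormN x : enorm (- x) = enorm x.
Proof. by rewrite -scaleN1r enormZ normrN1 mul1r. Qed.

Lemma enormB x y : enorm (x - y) = enorm (y - x).
Proof. by rewrite -enormN opprB. Qed.

Lemma dotp_enormB x y :
  dotp (x - y) (x - y) = dotp x x + dotp y y - 2 * dotp x y.
Proof. by rewrite dotpBl !dotpBr (dotpC y x); ring. Qed.

(** Cauchy-Schwarz: the square of [enorm y *: x - enorm x *: y] is nonnegative, and dividing it by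
    twice the product of the two norms gives the bound. *)
Lemma dotp_le x y : dotp x y <= enorm x * enorm y.
Proof.
have [->|y0] := eqVneq y 0; first by rewrite dotp0r enorm0 mulr0.
have [->|x0] := eqVneq x 0; first by rewrite dotp0l enorm0 mul0r.
have := dotp_ge0 (enorm y *: x - enorm x *: y).
rewrite dotp_enormB !dotpZl !dotpZr -!enorm_sqr.
set a := enorm x; set b := enorm y; set c := dotp x y => h.
have a0 : 0 < a by rewrite enorm_gt0.
have b0 : 0 < b by rewrite enorm_gt0.
have : 0 <= (a * b) * (a * b - c) by lra.
by rewrite pmulr_rge0 ?mulr_gt0 // subr_ge0.
Qed.

Lemma enormD x y : enorm (x + y) <= enorm x + enorm y.
Proof.
rewrite -(ler_pXn2r (n := 2)) ?nnegrE ?addr_ge0 ?enorm_ge0 //.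
rewrite enorm_sqr dotpDl !dotpDr (dotpC y x) sqrrD !enorm_sqr.
by have := dotp_le x y; lra.
Qed.

Lemma enorm_sum (I : Type) (s : seq I) (F : I -> 'rV[R]_d) :
  enorm (\sum_(i <- s) F i) <= \sum_(i <- s) enorm (F i).
Proof.
elim: s => [|i s IH]; first by rewrite !big_nil enorm0.
by rewrite !big_cons (le_trans (enormD _ _)) // lerD2l.
Qed.

Lemma coord_le_enorm x i : `|x 0 i| <= enorm x.
Proof.
rewrite -(ler_pXn2r (n := 2)) ?nnegrE ?enorm_ge0 //.
rewrite enorm_sqr dotpE (bigD1 i) //= real_normK ?num_real // expr2 lerDl.
by apply: sumr_ge0 => j _; rewrite -expr2 sqr_ge0.
Qed.

Lemma dotp_orth x y g : g *m g^T = 1%:M -> dotp (x *m g) (y *m g) = dotp x y.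
Proof. by move=> gg; rewrite dotpMl -mulmxA gg mulmx1. Qed.

Lemma enorm_orth x g : g *m g^T = 1%:M -> enorm (x *m g) = enorm x.
Proof. by move=> gg; rewrite /enorm dotp_orth. Qed.

Lemma le_enorm x y : dotp x x <= dotp y y -> enorm x <= enorm y.
Proof. exact: ler_wsqrtr. Qed.

End Euclid.

Section RowNorm.
Variables (R : realType).

(** A matrix norm that is submultiplicative, invariant under right multiplication by orthogonal
    matrices, and equal to [enorm] on row vectors. *)
Definition rnorm m n (A : 'M[R]_(m, n)) : R := \sum_i enorm (row i A).

Lemma rnorm_ge0 m n (A : 'M[R]_(m, n)) : 0 <= rnorm A.
Proof. by apply: sumr_ge0 => i _; exact: enorm_ge0. Qed.

Lemma rnormD m n (A B : 'M[R]_(m, n)) : rnorm (A + B) <= rnorm A + rnorm B.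
Proof.
rewrite -big_split /=; apply: ler_sum => i _.
by rewrite linearD /= enormD.
Qed.

Lemma rnormZ m n (a : R) (A : 'M[R]_(m, n)) : rnorm (a *: A) = `|a| * rnorm A.
Proof. by rewrite mulr_sumr; apply: eq_bigr => i _; rewrite linearZ /= enormZ. Qed.

Lemma rnormN m n (A : 'M[R]_(m, n)) : rnorm (- A) = rnorm A.
Proof. by rewrite -scaleN1r rnormZ normrN1 mul1r. Qed.

Lemma rnormB m n (A B : 'M[R]_(m, n)) : rnorm (A - B) = rnorm (B - A).
Proof. by rewrite -rnormN opprB. Qed.

Lemma rnorm0 m n : rnorm (0 : 'M[R]_(m, n)) = 0.
Proof. by rewrite -(scale0r 0) rnormZ normr0 mul0r. Qed.

Lemma rnorm_triangle m n (B A C : 'M[R]_(m, n)) :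
  rnorm (A - C) <= rnorm (A - B) + rnorm (B - C).
Proof. by rewrite (le_trans _ (rnormD _ _)) // addrA subrK. Qed.

Lemma rnorm_orth m n (A : 'M[R]_(m, n)) (g : 'M[R]_n) :
  g *m g^T = 1%:M -> rnorm (A *m g) = rnorm A.
Proof. by move=> gg; apply: eq_bigr => i _; rewrite row_mul enorm_orth. Qed.

Lemma enormM m n (x : 'rV[R]_m) (A : 'M[R]_(m, n)) :
  enorm (x *m A) <= enorm x * rnorm A.
Proof.
rewrite mulmx_sum_row (le_trans (enorm_sum _ _)) // mulr_sumr.
apply: ler_sum => i _; rewrite enormZ ler_wpM2r ?enorm_ge0 //.
exact: coord_le_enorm.
Qed.

Lemma rnormM m n p (A : 'M[R]_(m, n)) (B : 'M[R]_(n, p)) :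
  rnorm (A *m B) <= rnorm A * rnorm B.
Proof.
by rewrite mulr_suml; apply: ler_sum => i _; rewrite row_mul enormM.
Qed.

Lemma entry_le_rnorm m n (A : 'M[R]_(m, n)) i j : `|A i j| <= rnorm A.
Proof.
have := coord_le_enorm (row i A) j; rewrite mxE => /le_trans; apply.
by rewrite /rnorm (bigD1 i) //= lerDl sumr_ge0 // => k _; exact: enorm_ge0.
Qed.

Lemma rnorm_row n (x : 'rV[R]_n) : rnorm x = enorm x.
Proof. by rewrite /rnorm big_ord1 row_id. Qed.

Lemma enorm_le_sum n (x : 'rV[R]_n) : enorm x <= \sum_i `|x 0 i|.
Proof.
rewrite {1}[x]row_sum_delta (le_trans (enorm_sum _ _)) //; apply: ler_sum => i _.
rewrite enormZ ler_piMr // /enorm dotpE (bigD1 i) //= big1 ?addr0; last first.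
  by move=> j ji; rewrite !mxE (negbTE ji) andbF mul0r.
by rewrite !mxE !eqxx mulr1 sqrtr1.
Qed.

Lemma rnorm_le_sum m n (A : 'M[R]_(m, n)) : rnorm A <= \sum_i \sum_j `|A i j|.
Proof.
apply: ler_sum => i _; rewrite (le_trans (enorm_le_sum _)) //.
by apply: ler_sum => j _; rewrite mxE.
Qed.

End RowNorm.

(** * Orbits and stabilisers *)

Section UltraLimit.
Variables (R : realType) (U : set_system nat).
Hypothesis UU : UltraFilter U.

(** Replaces the extraction of subsequences: several sequences get their limits along the same [U].
    The limit is the supremum of the numbers that bound [f] from below on a set of [U]. *)
Lemma ultra_limit (f : nat -> R) (M : R) : (forall n, `|f n| <= M) ->
  exists l, forall e, 0 < e -> U [set n | `|f n - l| < e].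
Proof.
move=> fM; have PU := @ultra_proper _ U UU.
pose E := [set a | U [set n | a <= f n]].
have supE : has_sup E.
  split; first by exists (- M); apply: filterE => n /=; case/ler_normlP: (fM n); lra.
  exists M => a /filter_ex[n /= an]; apply: le_trans an _.
  by case/ler_normlP: (fM n).
exists (sup E) => e e0; have [a Ea la] := sup_adherent e0 supE.
have [Eb|nEb] := in_ultra_setVsetC [set n | sup E + e / 2 <= f n] UU.
  by have := sup_upper_bound supE Eb; lra.
apply: filterS (filterI Ea nEb) => n /= [an /negP]; rewrite -ltNge => bn.
by rewrite ltr_norml; apply/andP; split; lra.
Qed.

Lemma ultra_limit_mx m n (A : nat -> 'M[R]_(m, n)) (M : R) :
  (forall k, rnorm (A k) <= M) ->
  exists L, forall e, 0 < e -> U [set k | rnorm (A k - L) < e].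
Proof.
move=> AM; have PU := @ultra_proper _ U UU.
have /choice[L0 L0P] : forall ij : 'I_m * 'I_n, exists l : R,
    forall e, 0 < e -> U [set k | `|A k ij.1 ij.2 - l| < e].
  move=> ij; apply: (@ultra_limit _ M) => k.
  exact: le_trans (entry_le_rnorm _ _ _) (AM k).
exists (\matrix_(i, j) L0 (i, j)) => e e0.
(* There are [m * n] entries; the successor makes the final bound strict and covers the case of an
   empty matrix. *)
pose c : R := e / (m * n).+1%:R.
have c0 : 0 < c by rewrite divr_gt0.
have : U [set k | forall ij : 'I_m * 'I_n, `|A k ij.1 ij.2 - L0 ij| < c].
  by apply: filter_forall => ij; exact: L0P.
apply: filterS => k /= kP; apply: le_lt_trans (rnorm_le_sum _) _.
apply: (@le_lt_trans _ _ (\sum_(i < m) \sum_(j < n) c)).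
  by apply: ler_sum => i _; apply: ler_sum => j _; rewrite !mxE ltW // (kP (i, j)).
rewrite !sumr_const !card_ord -mulrnA mulnC -mulr_natl /c mulrCA.
rewrite gtr_pMr // ltr_pdivrMr // mul1r ltr_nat //.
Qed.

End UltraLimit.

(** An ultrafilter refining the tails, so that its limits are limits at infinity. *)
Lemma ultra_tail : exists U : set_system nat,
  UltraFilter U /\ forall N, U [set n | (N <= n)%N].
Proof.
have [U [UU sU]] := @ultraFilterLemma _ _ eventually_filter.
by exists U; split => // N; apply: sU; exact: nbhs_infty_ge.
Qed.

(** * The group of linear maps preserving every orbit, and its stabilisers *)

Section OrbitGroup.
Variables (R : realType) (d : nat) (G : set 'M[R]_d).
Hypothesis hG : orthogonal_subgroup G.
Implicit Types (x y z : 'rV[R]_d) (g h k : 'M[R]_d).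

Lemma group_orth g : G g -> g *m g^T = 1%:M.
Proof. by case: hG => _ _ _; apply. Qed.

Lemma group1 : G 1%:M. Proof. by case: hG. Qed.

Lemma groupM g h : G g -> G h -> G (g *m h).
Proof. by case: hG => _ + _ _; apply. Qed.

Lemma orth_invmx g : g *m g^T = 1%:M -> invmx g = g^T.
Proof.
move=> gg; have [ug _] := mulmx1_unit gg.
by rewrite -[RHS]mul1mx -(mulVmx ug) -mulmxA gg mulmx1.
Qed.

Lemma group_tr g : G g -> G g^T.
Proof.
by move=> Gg; rewrite -orth_invmx ?group_orth //; case: hG => _ _ + _; apply.
Qed.

Lemma orbit_refl x : orbit G x x.
Proof. by exists 1%:M; rewrite ?mulmx1 //; exact: group1. Qed.

Lemma orbitM x g : G g -> orbit G x (x *m g).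
Proof. by move=> Gg; exists g. Qed.

Lemma orbit_trans y x z : orbit G x y -> orbit G y z -> orbit G x z.
Proof.
by move=> [g Gg <-] [h Gh <-]; rewrite -mulmxA; apply: orbitM; exact: groupM.
Qed.

Lemma orbit_sym x y : orbit G x y -> orbit G y x.
Proof.
move=> [g Gg <-]; exists g^T; first exact: group_tr.
by rewrite -mulmxA group_orth // mulmx1.
Qed.

Lemma orbit_eq x y : orbit G x y -> orbit G y = orbit G x.
Proof.
move=> xy; apply/seteqP; split => z; first exact: orbit_trans.
by apply: orbit_trans; exact: orbit_sym.
Qed.

Lemma orbit_norm x y : orbit G x y -> dotp y y = dotp x x.
Proof. by move=> [g Gg <-]; rewrite dotp_orth // group_orth. Qed.

(* The largest linear group with the same orbits as G: unlike G itself it is closed. *)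
Definition orbit_group : set 'M[R]_d := [set g | forall x, orbit G x (x *m g)].

Lemma sub_orbit_group g : G g -> orbit_group g.
Proof. by move=> Gg x; exact: orbitM. Qed.

(** A linear map keeping each vector in its orbit preserves norms, hence inner products by
    polarisation. *)
Lemma orbit_group_orth g : orbit_group g -> g *m g^T = 1%:M.
Proof.
move=> Hg.
have pres x y : dotp (x *m g) (y *m g) = dotp x y.
  have := orbit_norm (Hg (x + y)).
  rewrite mulmxDl !dotpDl !dotpDr (orbit_norm (Hg x)) (orbit_norm (Hg y)).
  by rewrite (dotpC (y *m g)) (dotpC y); lra.
apply/eqP; rewrite -subr_eq0; apply/eqP/row_matrixP => i.
apply/eqP; rewrite row0 -dotp_eq0 rowE; set x := delta_mx _ _.
set v := (x *m _); rewrite {1}/v mulmxBr mulmx1 dotpBl mulmxA.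
by rewrite [X in X - _]dotpMl trmxK pres subrr.
Qed.

Lemma orbit_group1 : orbit_group 1%:M.
Proof. by apply: sub_orbit_group; exact: group1. Qed.

Lemma orbit_groupM g h : orbit_group g -> orbit_group h -> orbit_group (g *m h).
Proof. by move=> Hg Hh x; rewrite mulmxA; apply: orbit_trans (Hg x) (Hh _). Qed.

Lemma orbit_group_tr g : orbit_group g -> orbit_group g^T.
Proof.
move=> Hg x; apply: orbit_sym; have := Hg (x *m g^T).
by rewrite -mulmxA (mulmx1C (orbit_group_orth Hg)) mulmx1.
Qed.

Definition stab (q : 'rV[R]_d) : set 'M[R]_d := [set k | orbit_group k /\ q *m k = q].

Hypothesis hclosed : closed_orbits G.

(** For each x, [x *m L] is a limit of points of the orbit of x, which is closed. *)
Lemma orbit_group_closed L :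
  (forall e, 0 < e -> exists2 g, orbit_group g & rnorm (g - L) < e) -> orbit_group L.
Proof.
move=> HL x; apply: hclosed => e e0.
have c0 : 0 < e / (enorm x + 1) by rewrite divr_gt0 // ltr_wpDl // enorm_ge0.
have [g Hg gL] := HL _ c0; exists (x *m g); first exact: Hg.
rewrite -mulmxBr; apply: le_lt_trans (enormM _ _) _.
move: gL; rewrite ltr_pdivlMr ?ltr_wpDl ?enorm_ge0 // mulrDr mulr1.
by have := rnorm_ge0 (g - L); rewrite (mulrC (enorm x)); lra.
Qed.

Lemma orth_rnorm g : g *m g^T = 1%:M -> rnorm g = rnorm (1%:M : 'M[R]_d).
Proof. by move=> gg; rewrite -(rnorm_orth 1%:M gg) mul1mx. Qed.

Local Notation pow h m := (iter m (fun A : 'M[R]_d => A *m h) 1%:M).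

Lemma orbit_group_pow h m : orbit_group h -> orbit_group (pow h m).
Proof.
by move=> Hh; elim: m => [|m IH] /=; [exact: orbit_group1|exact: orbit_groupM].
Qed.

Lemma rnorm_pow1 h m : orbit_group h ->
  rnorm (pow h m - 1%:M) <= m%:R * rnorm (h - 1%:M).
Proof.
move=> Hh; elim: m => [|m IH] /=; first by rewrite subrr rnorm0 mul0r.
apply: le_trans (rnorm_triangle h _ _) _.
have -> : pow h m *m h - h = (pow h m - 1%:M) *m h by rewrite mulmxBl mul1mx.
by rewrite rnorm_orth ?orbit_group_orth // -natr1 mulrDl mul1r lerD2r.
Qed.

(** Powers of an element near 1 are affine in the exponent up to second order; in the limit they
    trace a curve with prescribed direction. *)
Lemma rnorm_pow2 h m : orbit_group h ->
  rnorm (pow h m - 1%:M - m%:R *: (h - 1%:M)) <= (m%:R * rnorm (h - 1%:M)) ^+ 2.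
Proof.
move=> Hh; elim: m => [|m IH] /=.
  by rewrite subrr scale0r subrr rnorm0 mul0r expr0n.
have -> : pow h m *m h - 1%:M - m.+1%:R *: (h - 1%:M) =
    (pow h m - 1%:M - m%:R *: (h - 1%:M)) + (pow h m - 1%:M) *m (h - 1%:M).
  rewrite -natr1 scalerDl scale1r mulmxBl mulmxBr mulmx1 mul1mx.
  move: (iter m _ _) => P; move: (P *m h) => Q.
  by apply/matrixP => i j; rewrite !mxE; ring.
apply: le_trans (rnormD _ _) _; apply: le_trans (lerD IH (rnormM _ _)) _.
have := rnorm_pow1 m Hh; set a := rnorm (_ - _); set t := rnorm (h - _) => at_.
have t0 : 0 <= t by exact: rnorm_ge0.
have m0 : 0 <= m%:R :> R by [].
rewrite -natr1; move: at_ m0; move: (m%:R : R) => u at_ u0.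
have := ler_wpM2r t0 at_; have := mulr_ge0 u0 (sqr_ge0 t); have := sqr_ge0 t.
lra.
Qed.

Lemma enorm_pow q h m : orbit_group h ->
  enorm (q *m pow h m - q) <= m%:R * enorm (q *m h - q).
Proof.
move=> Hh; elim: m => [|m IH] /=; first by rewrite mulmx1 subrr enorm0 mul0r.
have -> : q *m (pow h m *m h) - q = (q *m pow h m - q) *m h + (q *m h - q).
  by rewrite mulmxBl mulmxA addrA subrK.
apply: le_trans (enormD _ _) _; rewrite enorm_orth ?orbit_group_orth //.
by rewrite -natr1 mulrDl mul1r lerD2r.
Qed.

Lemma stab_closed q L :
  (forall e, 0 < e -> exists g,
     [/\ orbit_group g, rnorm (g - L) < e & enorm (q *m g - q) < e]) ->
  stab q L.
Proof.
move=> HL; split.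
  by apply: orbit_group_closed => e /HL[g [Hg gL _]]; exists g.
apply/eqP; rewrite -subr_eq0 -enorm_eq0 eq_le enorm_ge0 andbT.
apply/ler_addgt0Pr => e e0; rewrite add0r.
have q1 : 0 < enorm q + 1 by rewrite ltr_wpDl // enorm_ge0.
have [g [_ gL gq]] := HL _ (divr_gt0 e0 q1).
have -> : q *m L - q = q *m (L - g) + (q *m g - q) by rewrite mulmxBr addrA subrK.
apply: le_trans (enormD _ _) _; apply: le_trans (lerD (enormM _ _) (ltW gq)) _.
rewrite rnormB in gL; move: gL gq; set c := e / _ => gL gq.
have -> : e = enorm q * c + c by rewrite /c; field; rewrite gt_eqF.
by rewrite lerD2r ler_wpM2l ?enorm_ge0 // ltW.
Qed.

(* If no k halves the distance along a sequence h_n, then h_n -> 1 and the powers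
   h_n ^ (t / |h_n - 1|) converge, for every t, to an element of the stabiliser
   that agrees with 1 + t X up to t^2, X being the limit direction of h_n - 1;
   for t = |h_n - 1| it is a better approximation of h_n than 1. *)
Lemma stab_halving q : exists2 eta : R, 0 < eta &
  forall h, orbit_group h -> enorm (q *m h - q) <= eta * rnorm (h - 1%:M) ->
    exists2 k, stab q k & rnorm (h - k) <= rnorm (h - 1%:M) / 2.
Proof.
apply: contrapT => N.
have /choice[h hP] : forall n : nat, exists h, [/\ orbit_group h,
    enorm (q *m h - q) <= n.+1%:R^-1 * rnorm (h - 1%:M) &
    forall k, stab q k -> rnorm (h - 1%:M) / 2 < rnorm (h - k)].
  move=> n; apply: contrapT => Nn; apply: N; exists n.+1%:R^-1.
    by rewrite invr_gt0.
  move=> h Hh hq; apply: contrapT => Nk; apply: Nn; exists h; split=> // k Sk.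
  by rewrite ltNge; apply/negP => le; apply: Nk; exists k.
pose dl n := rnorm (h n - 1%:M); pose Y n := (dl n)^-1 *: (h n - 1%:M).
have Hh n : orbit_group (h n) by case: (hP n).
have far n k : stab q k -> dl n / 2 < rnorm (h n - k) by case: (hP n) => _ _; apply.
have dl0 n : 0 < dl n.
  have := far n _ (conj orbit_group1 (mulmx1 q)); rewrite -/(dl n); lra.
have Y1 n : rnorm (Y n) = 1.
  by rewrite rnormZ ger0_norm ?invr_ge0 ?(ltW (dl0 n)) // mulVf ?gt_eqF.
have [U [UU tail]] := ultra_tail; have PU := @ultra_proper _ U UU.
have bnd (g : nat -> 'M[R]_d) (Hg : forall n, orbit_group (g n)) n :
    rnorm (g n) <= rnorm (1%:M : 'M[R]_d).
  by rewrite (orth_rnorm (orbit_group_orth (Hg n))).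
have qsmall n m e : 0 < e -> m%:R * dl n / e < n%:R ->
    enorm (q *m pow (h n) m - q) < e.
  move=> e0 me; apply: le_lt_trans (enorm_pow q m (Hh n)) _.
  have [_ hq _] := hP n; apply: le_lt_trans (ler_wpM2l (ler0n _ _) hq) _.
  rewrite mulrCA -/(dl n) mulrC ltr_pdivrMr // [ltRHS]mulrC -ltr_pdivrMr //.
  by apply: lt_trans me _; rewrite ltr_nat.
have archi (x : R) : U [set n | x < n%:R].
  apply: filterS (tail (Num.truncn `|x|).+1) => n /= xn.
  apply: le_lt_trans (ler_norm x) _; rewrite -truncn_lt_nat //.
have [L LP] := ultra_limit_mx UU (bnd h Hh).
have SL : stab q L.
  apply: stab_closed => e e0.
  have [n /= [nL ne]] := filter_ex (filterI (LP e e0) (archi (2 * rnorm (1%:M : 'M[R]_d) / e))).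
  exists (h n); split=> //; rewrite -[h n]mul1mx; apply: (qsmall n 1%N) => //.
  apply: le_lt_trans ne; rewrite ler_pM2r ?invr_gt0 // mul1r.
  apply: le_trans (rnormD _ _) _; rewrite rnormN mulr_natl mulr2n lerD2r.
  exact: bnd.
(* [L] lies in the stabiliser, so [h n] is farther than [dl n / 2] from it; convergence to [L]
   forces [dl n] to 0. *)
have dlU e : 0 < e -> U [set n | dl n < e].
  move=> e0; have e2 : 0 < e / 2 by rewrite divr_gt0.
  apply: filterS (LP _ e2) => n /= nL.
  by have := far n L SL; lra.
have [X XP] : exists X, forall e, 0 < e -> U [set n | rnorm (Y n - X) < e].
  by apply: (ultra_limit_mx UU (M := 1)) => n; rewrite Y1.
have curve t : 0 < t -> exists2 k, stab q k & rnorm (k - 1%:M - t *: X) <= t ^+ 2.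
  (* [m n] steps of length [dl n] cover the length t up to less than one step. *)
  move=> t0; pose m n := Num.truncn (t / dl n).
  have mt n : t - dl n <= (m n)%:R * dl n <= t.
    have /andP[m1 m2] := truncn_itv (ltW (divr_gt0 t0 (dl0 n))).
    rewrite ler_pdivlMr // in m1; rewrite ltr_pdivrMr // -natr1 mulrDl mul1r in m2.
    by rewrite m1 andbT; rewrite -/(m n) in m2; lra.
  have Hp n : orbit_group (pow (h n) (m n)) by exact: orbit_group_pow.
  have [k kP] := ultra_limit_mx UU (bnd _ Hp).
  exists k.
    apply: stab_closed => e e0.
    have [n /= [nk ne]] := filter_ex (filterI (kP e e0) (archi (t / e))).
    exists (pow (h n) (m n)); split=> //; apply: qsmall => //.
    by apply: le_lt_trans ne; rewrite ler_pM2r ?invr_gt0 //; case/andP: (mt n).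
  apply/ler_addgt0Pr => e0 e00; pose e := e0 / (2 + t).
  have e_gt0 : 0 < e by rewrite divr_gt0 // addr_gt0.
  have [n /= [nk [nd nX]]] := filter_ex (filterI (kP e e_gt0)
    (filterI (dlU e e_gt0) (XP e e_gt0))).
  have -> : e0 = e + (e + t * e) by rewrite /e; field; rewrite gt_eqF // addr_gt0.
  set Q := pow _ _ in nk.
  have -> : k - 1%:M - t *: X = (k - Q) + ((Q - 1%:M - (m n)%:R *: (h n - 1%:M)) +
     (((m n)%:R * dl n - t) *: Y n + t *: (Y n - X))).
    have -> : h n - 1%:M = dl n *: Y n by rewrite scalerA divff ?gt_eqF // scale1r.
    by apply/matrixP => i j; rewrite !mxE; ring.
  have [mt1 mt2] := andP (mt n).
  have n1 : rnorm (k - Q) <= e by rewrite rnormB ltW.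
  have n2 : rnorm (Q - 1%:M - (m n)%:R *: (h n - 1%:M)) <= t ^+ 2.
    apply: le_trans (rnorm_pow2 (m n) (Hh n)) _.
    by rewrite ler_pXn2r ?nnegrE ?mulr_ge0 ?rnorm_ge0 ?(ltW t0).
  have n3 : rnorm (((m n)%:R * dl n - t) *: Y n) <= e.
    by rewrite rnormZ Y1 mulr1 ler0_norm ?subr_le0 //; lra.
  have n4 : rnorm (t *: (Y n - X)) <= t * e.
    by rewrite rnormZ gtr0_norm // ler_pM2l // ltW.
  apply: le_trans (rnormD _ _) _; have := rnormD (Q - 1%:M - (m n)%:R *: (h n - 1%:M))
    (((m n)%:R * dl n - t) *: Y n + t *: (Y n - X)).
  have := rnormD (((m n)%:R * dl n - t) *: Y n) (t *: (Y n - X)).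
  by move: n1 n2 n3 n4; lra.
(* With [dl n] and the error of [Y n] below 1/8, the curve at time [dl n] passes within
   [dl n / 8 + dl n ^+ 2 < dl n / 2] of [h n], a contradiction. *)
have e8 : 0 < 8^-1 :> R by rewrite invr_gt0.
have [n /= [nd nX]] := filter_ex (filterI (dlU _ e8) (XP _ e8)).
have [k Sk kX] := curve _ (dl0 n); have := far n k Sk.
have -> : h n - k = dl n *: (Y n - X) - (k - 1%:M - dl n *: X).
  rewrite scalerBr scalerA divff ?gt_eqF // scale1r.
  by apply/matrixP => i j; rewrite !mxE; ring.
have := rnormD (dl n *: (Y n - X)) (- (k - 1%:M - dl n *: X)).
rewrite rnormN rnormZ gtr0_norm //; have d0 := dl0 n.
have := ler_wpM2l (ltW d0) (ltW nX); have := ler_wpM2l (ltW d0) (ltW nd).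
move: kX; rewrite expr2; lra.
Qed.

(** Divide h by a nearly nearest k of the stabiliser: [h *m k^T] displaces q as much as h does. Were
    this displacement too small, [stab_halving] would produce an element of the stabiliser closer to
    h than the infimum of the distances. *)
Lemma stab_dist q : exists2 c : R, 0 < c &
  forall h, orbit_group h -> exists2 k, stab q k & rnorm (h - k) <= c * enorm (q *m h - q).
Proof.
have [eta eta0 halve] := stab_halving q.
exists eta^-1; first by rewrite invr_gt0.
move=> h Hh; pose E := [set rnorm (h - k) | k in stab q].
have S1 : stab q 1%:M by split; [exact: orbit_group1|rewrite mulmx1].
have E0 : E (rnorm (h - 1%:M)) by exists 1%:M.
have lbE : has_lbound E by exists 0 => _ [k _ <-]; exact: rnorm_ge0.
have infE0 : 0 <= inf E.
  by apply: lb_le_inf => [|_ [k _ <-]]; [exists (rnorm (h - 1%:M))|exact: rnorm_ge0].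
(* At distance 0, h itself fixes q, because the stabiliser is closed. *)
have [infE|infE] := ltP 0 (inf E); last first.
  exists h; last by rewrite subrr rnorm0 mulr_ge0 ?invr_ge0 ?(ltW eta0) ?enorm_ge0.
  apply: stab_closed => e e0.
  exists h; rewrite subrr rnorm0; split => //.
  have q1 : 0 < enorm q + 1 by rewrite ltr_wpDl // enorm_ge0.
  have [_ [k [_ qk] <-]] : exists2 z, E z & z < inf E + e / (enorm q + 1).
    by apply: inf_adherent; [rewrite divr_gt0|split=> //; exists (rnorm (h - 1%:M))].
  move=> hk; have hk' : rnorm (h - k) < e / (enorm q + 1) by lra.
  rewrite -{2}qk -mulmxBr; apply: le_lt_trans (enormM _ _) _.
  move: hk'; rewrite ltr_pdivlMr // mulrDr mulr1 (mulrC (enorm q)).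
  by have := rnorm_ge0 (h - k); lra.
(* Within 3/2 of the infimum: after halving, the distance is at most 3/4 of it. *)
have [_ [k [Hk qk] <-] hk] : exists2 z, E z & z < inf E + inf E / 2.
  by apply: inf_adherent; [rewrite divr_gt0|split=> //; exists (rnorm (h - 1%:M))].
exists k; first by [].
have kk := orbit_group_orth Hk; have kk' := mulmx1C kk.
have hkE : h - k = (h *m k^T - 1%:M) *m k.
  by rewrite mulmxBl -mulmxA kk' mulmx1 mul1mx.
have qhE : enorm (q *m (h *m k^T) - q) = enorm (q *m h - q).
  rewrite -[LHS](enorm_orth _ kk) mulmxBl qk -!mulmxA kk' mulmx1 //.
rewrite hkE rnorm_orth // ler_pdivlMl // -qhE leNgt; apply/negP => lt.
have [k' [Hk' qk']] := halve _ (orbit_groupM Hh (orbit_group_tr Hk)) (ltW lt).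
rewrite -(rnorm_orth (_ - k') kk) -(rnorm_orth (_ - 1%:M) kk) -hkE.
rewrite mulmxBl -mulmxA kk' mulmx1 => hk'.
have : inf E <= rnorm (h - k' *m k).
  apply: ge_inf => //; exists (k' *m k) => //; split; first exact: orbit_groupM.
  by rewrite mulmxA qk' qk.
by lra.
Qed.

End OrbitGroup.

(** * The max filtering kernel *)

Section MaxFiltering.
Variables (R : realType) (d : nat) (G : set 'M[R]_d).
Hypothesis hG : orthogonal_subgroup G.
Implicit Types (x y z w : 'rV[R]_d) (g h k : 'M[R]_d).
Local Notation K := (maxfilt G).

Lemma maxfilt_has_sup x y : has_sup [set dotp p q | p in orbit G x & q in orbit G y].
Proof.
split; first by exists (dotp x y); exists x; [|exists y]; rewrite //; exact: orbit_refl.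
exists (enorm x * enorm y) => _ [p xp [q yq <-]].
by apply: le_trans (dotp_le _ _) _; rewrite /enorm (orbit_norm hG xp) (orbit_norm hG yq).
Qed.

Lemma maxfilt_ge x y p q : orbit G x p -> orbit G y q -> dotp p q <= K x y.
Proof.
move=> xp yq; apply: (sup_upper_bound (maxfilt_has_sup x y)).
by exists p => //; exists q.
Qed.

Lemma maxfilt_orbit x y p q : orbit G x p -> orbit G y q -> K p q = K x y.
Proof. by move=> xp yq; rewrite /maxfilt (orbit_eq hG xp) (orbit_eq hG yq). Qed.

Lemma dotp_le_maxfilt x y : dotp x y <= K x y.
Proof. by apply: maxfilt_ge; exact: orbit_refl. Qed.

Hypothesis hclosed : closed_orbits G.

(** By orthogonality only one argument has to move, and its orbit is bounded and closed, so
    near-maximisers have a limit in the orbit. *)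
Lemma maxfilt_attained x y : exists2 g, G g & dotp (x *m g) y = K x y.
Proof.
have /choice[r rP] : forall n : nat, exists r, orbit G x r /\ K x y - n.+1%:R^-1 < dotp r y.
  move=> n; have n0 : 0 < n.+1%:R^-1 :> R by rewrite invr_gt0.
  have [_ [_ [g Gg <-] [_ [h Gh <-] <-]] Kn] := sup_adherent n0 (maxfilt_has_sup x y).
  exists (x *m g *m h^T); split.
    by rewrite -mulmxA; apply: orbitM; apply: groupM => //; exact: group_tr.
  by rewrite dotpMl trmxK.
have [U [UU tail]] := ultra_tail; have PU := @ultra_proper _ U UU.
have [|L LP] := ultra_limit_mx UU (A := r) (M := enorm x).
  by move=> n; rewrite rnorm_row /enorm; have [xr _] := rP n; rewrite (orbit_norm hG xr).
have [g Gg gL] : orbit G x L.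
  apply: hclosed => e /LP/filter_ex[n /=]; rewrite rnorm_row => ne.
  by exists (r n) => //; case: (rP n).
exists g => //; rewrite gL; apply/eqP; rewrite eq_le maxfilt_ge //=; last first.
- exact: orbit_refl.
- by rewrite -gL; exact: orbitM.
apply/ler_addgt0Pr => e e0; pose c := e / (enorm y + 1).
have y1 : 0 < enorm y + 1 by rewrite ltr_wpDl // enorm_ge0.
have c0 : 0 < c by rewrite divr_gt0.
have [n /= [nL nc]] := filter_ex (filterI (LP c c0) (tail (Num.truncn c^-1))).
have nc' : n.+1%:R^-1 <= c.
  rewrite -[c]invrK lef_pV2 ?posrE ?invr_gt0 //.
  by apply: ltW; rewrite -truncn_lt_nat ?invr_ge0 ?(ltW c0).
have [_ Kn] := rP n; have := dotp_le (r n - L) y; rewrite dotpBl.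
rewrite rnorm_row in nL.
have -> : e = c * enorm y + c by rewrite /c; field; rewrite gt_eqF.
have := ler_wpM2r (enorm_ge0 y) (ltW nL).
move: nc' Kn; move: (n.+1%:R^-1) (_ * enorm y) (c * _) => a b e'; lra.
Qed.

Lemma maxfilt_self x : K x x = dotp x x.
Proof.
apply/eqP; rewrite eq_le dotp_le_maxfilt andbT.
have [g Gg <-] := maxfilt_attained x x; apply: le_trans (dotp_le _ _) _.
by rewrite enorm_orth ?(group_orth hG) // -expr2 enorm_sqr.
Qed.

Lemma maxfiltC x y : K x y = K y x.
Proof.
suff le u v : K u v <= K v u by apply/eqP; rewrite eq_le !le.
have [g Gg <-] := maxfilt_attained u v; rewrite dotpC; apply: maxfilt_ge.
  exact: orbit_refl.
exact: orbitM.
Qed.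

Lemma maxfilt_subadd w x y : K w (x + y) <= K w x + K w y.
Proof.
have [g Gg <-] := maxfilt_attained w (x + y); rewrite dotpDr lerD //;
  apply: maxfilt_ge; [exact: orbitM|exact: orbit_refl|exact: orbitM|exact: orbit_refl].
Qed.

Lemma maxfilt0 w : K w 0 = 0.
Proof. by have [g _ <-] := maxfilt_attained w 0; rewrite dotp0r. Qed.

Definition aligned x y : Prop := dotp x y = K x y.

Lemma alignedC x y : aligned x y -> aligned y x.
Proof. by rewrite /aligned dotpC maxfiltC. Qed.

Lemma alignedxx x : aligned x x.
Proof. by rewrite /aligned maxfilt_self. Qed.

Lemma aligned_orbit x y g : orbit_group G g -> aligned x y -> aligned (x *m g) (y *m g).
Proof.
move=> Hg xy; rewrite /aligned (dotp_orth _ _ (orbit_group_orth hG Hg)).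
by rewrite (maxfilt_orbit (Hg x) (Hg y)).
Qed.

Lemma aligned_ge x y : K x y <= dotp x y -> aligned x y.
Proof. by move=> le; apply/eqP; rewrite eq_le le dotp_le_maxfilt. Qed.

Hypothesis Kpd : pos_def_kernel K.

(* The feature map of K is additive on aligned vectors: the Gram form vanishes
   on the combination (x + y) - x - y, hence so does its pairing with w. *)
Lemma maxfiltD w x y : aligned x y -> K w (x + y) = K w x + K w y.
Proof.
move=> xy; apply/eqP; rewrite eq_le maxfilt_subadd leNgt; apply/negP => lt.
have [_ psd] := Kpd.
pose k := K w w; pose L := K w (x + y) - K w x - K w y.
have k0 : 0 <= k by rewrite /k maxfilt_self dotp_ge0.
have L0 : L < 0 by rewrite /L; lra.
(* The form with coefficients 1, -1, -1, t equals [t * (2 * L + t * k)]. This t gives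
   [L + t * k = L / (k + 1) < 0], also when k is 0. *)
pose t := - L / (k + 1).
have := psd 4 (fun i => nth 0 [:: x + y; x; y; w] i)
              (fun i => nth 0 [:: 1; -1; -1; t] i).
rewrite !big_ord_recl !big_ord0 /= !addr0.
have Kx : K (x + y) x = dotp x x + dotp y x.
  apply/eqP; rewrite eq_le -dotpDl dotp_le_maxfilt andbT maxfiltC.
  apply: le_trans (maxfilt_subadd _ _ _) _.
  by rewrite maxfilt_self -xy dotpDl (dotpC y).
have Ky : K (x + y) y = dotp x y + dotp y y.
  apply/eqP; rewrite eq_le -dotpDl dotp_le_maxfilt andbT maxfiltC.
  apply: le_trans (maxfilt_subadd _ _ _) _.
  by rewrite maxfilt_self maxfiltC -xy dotpDl.
rewrite (maxfiltC x (x + y)) (maxfiltC y (x + y)) (maxfiltC x w) (maxfiltC y w).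
rewrite (maxfiltC (x + y) w) (maxfiltC y x) Kx Ky !maxfilt_self -xy.
rewrite !dotpDl !dotpDr (dotpC y x) -(maxfilt_self w) -/k.
have Lk : L + t * k < 0.
  have -> : L + t * k = L / (k + 1) by rewrite /t; field; rewrite gt_eqF // ltr_wpDl.
  by rewrite pmulr_llt0 // invr_gt0 ltr_wpDl.
have t0 : 0 < t by rewrite divr_gt0 ?oppr_gt0 // ltr_wpDl.
have LE : K w (x + y) = L + K w x + K w y by rewrite /L; ring.
have h : t * (2 * L + t * k) < 0 by rewrite pmulr_rlt0 //; lra.
by rewrite LE; lra.
Qed.

Lemma maxfilt_sum (I : Type) (s : seq I) (F : I -> 'rV[R]_d) w :
  (forall i j, aligned (F i) (F j)) ->
  K w (\sum_(i <- s) F i) = \sum_(i <- s) K w (F i).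
Proof.
move=> al; elim: s w => [|i s IH] w; first by rewrite !big_nil maxfilt0.
rewrite !big_cons maxfiltD ?IH //.
by rewrite /aligned IH dotp_sumr; apply: eq_bigr => j _; exact: al.
Qed.

(** The gaps [K w (F i) - dotp w (F i)] are nonnegative and sum to zero. *)
Lemma aligned_sum (I : finType) (F : I -> 'rV[R]_d) w :
  (forall i j, aligned (F i) (F j)) ->
  aligned w (\sum_i F i) -> forall i, aligned w (F i).
Proof.
move=> al; rewrite /aligned maxfilt_sum // dotp_sumr => /esym/eqP.
rewrite -subr_eq0 -sumrB => /eqP /psumr_eq0P h i.
by apply/eqP; rewrite eq_sym -subr_eq0 h // => j _; rewrite subr_ge0 dotp_le_maxfilt.
Qed.

Lemma sum_aligned (I : finType) (F : I -> 'rV[R]_d) w :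
  (forall i j, aligned (F i) (F j)) ->
  (forall i, aligned w (F i)) -> aligned w (\sum_i F i).
Proof.
by move=> al wal; rewrite /aligned maxfilt_sum // dotp_sumr; apply: eq_bigr => i _; exact: wal.
Qed.

(** Move w so that its product with the sum of the family is maximal. *)
Lemma align (I : finType) (F : I -> 'rV[R]_d) w :
  (forall i j, aligned (F i) (F j)) ->
  exists2 g, G g & forall i, aligned (w *m g) (F i).
Proof.
move=> al; have [g Gg gE] := maxfilt_attained w (\sum_i F i).
exists g => //; apply: aligned_sum => //; rewrite /aligned gE.
by apply/esym; apply: maxfilt_orbit; [exact: orbitM|exact: orbit_refl].
Qed.

End MaxFiltering.

(** * Maximal aligned families *)

Section Chamber.
Variables (R : realType) (d : nat) (G : set 'M[R]_d).
Hypothesis hG : orthogonal_subgroup G.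
Hypothesis hclosed : closed_orbits G.
Implicit Types (x y z w s u : 'rV[R]_d) (g h k : 'M[R]_d).
Local Notation K := (maxfilt G).

Definition aligned_rows m (A : 'M[R]_(m, d)) := forall i j, aligned G (row i A) (row j A).

Definition chamber m (A : 'M[R]_(m, d)) w := forall i, aligned G w (row i A).

Lemma row_free_col_mx m (A : 'M[R]_(m, d)) w :
  row_free A -> ~~ (w <= A)%MS -> row_free (col_mx w A).
Proof.
move=> fA wA; rewrite /row_free eqn_leq rank_leq_row /=.
have /rank_ltmx : (A < A + w)%MS.
  by rewrite ltmxE addsmxSl /= addsmx_sub submx_refl.
by rewrite (eqP fA) addsmxC addsmxE.
Qed.

Lemma aligned_rows_col_mx m (A : 'M[R]_(m, d)) w :
  aligned_rows A -> chamber A w -> aligned_rows (col_mx w A).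
Proof.
move=> aA cw i j.
have rowE a : row a (col_mx w A) = w \/ exists l, row a (col_mx w A) = row l A.
  case: (split_ordP a) => l ->; rewrite ?rowKu ?rowKd; [left|right; by exists l].
  by rewrite ord1 row_id.
case: (rowE i) => [->|[k ->]]; case: (rowE j) => [->|[l ->]] //.
- exact: alignedxx.
- by apply: alignedC => //; exact: cw.
Qed.

Lemma aligned_quad x y h : orbit_group G h -> aligned G x y ->
  `|dotp (x *m h - x) y| <= enorm (x *m h - x) * enorm (y *m h - y).
Proof.
move=> Hh xy; have hh := orbit_group_orth hG Hh.
have Hle g : orbit_group G g -> dotp (x *m g) y <= dotp x y.
  by move=> Hg; rewrite xy; apply: maxfilt_ge => //; exact: orbit_refl.
have h1 := Hle h Hh; have h2 := Hle _ (orbit_group_tr hG Hh).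
rewrite ler0_norm dotpBl; last by rewrite subr_le0.
(* The product [dotp (x *m h - x) (y *m h - y)] equals [2 * dotp x y - dotp (x *m h) y - dotp (x *m
   h^T) y], and the last term is at most [dotp x y] by alignment. *)
apply: le_trans (dotp_le (x *m h - x) (y *m h - y)).
have xyh : dotp x (y *m h) = dotp (x *m h^T) y by rewrite dotpMl trmxK.
by rewrite dotpBr !dotpBl dotp_orth // xyh; move: h2; lra.
Qed.

Lemma subspace_quad m (A : 'M[R]_(m, d)) s u : aligned_rows A ->
  (s <= A)%MS -> (u <= A)%MS -> exists2 c : R, 0 <= c & forall h, orbit_group G h ->
    `|dotp (s *m h - s) u| <= c * dotp (s *m h - s) (s *m h - s).
Proof.
move=> aA /submxP[a sE] /submxP[b uE].
pose c0 := \sum_i \sum_j `|a 0 i| * `|b 0 j| * (enorm (row i A) * enorm (row j A)).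
have c00 : 0 <= c0.
  by apply: sumr_ge0 => i _; apply: sumr_ge0 => j _; rewrite !mulr_ge0 ?enorm_ge0.
(* The bound for pairs of rows extends bilinearly to the span, but only in terms of the distance
   from h to 1. *)
have quad h : orbit_group G h -> `|dotp (s *m h - s) u| <= c0 * rnorm (h - 1%:M) ^+ 2.
  move=> Hh.
  have -> : s *m h - s = \sum_i a 0 i *: (row i A *m h - row i A).
    rewrite sE (mulmx_sum_row a A) mulmx_suml -sumrB; apply: eq_bigr => i _.
    by rewrite scalerBr scalemxAl.
  rewrite uE mulmx_sum_row dotp_suml (le_trans (ler_norm_sum _ _ _)) //.
  rewrite mulr_suml; apply: ler_sum => i _.
  rewrite dotp_sumr (le_trans (ler_norm_sum _ _ _)) //.
  rewrite mulr_suml; apply: ler_sum => j _.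
  rewrite dotpZl dotpZr !normrM [leLHS]mulrA -[leRHS]mulrA ler_wpM2l ?mulr_ge0 //.
  apply: le_trans (aligned_quad Hh (aA i j)) _.
  have nh x : x *m h - x = x *m (h - 1%:M) by rewrite mulmxBr mulmx1.
  by rewrite expr2 mulrACA !nh ler_pM ?enorm_ge0 // enormM.
have [c c_gt0 dist] := stab_dist hG hclosed s.
exists (c0 * c ^+ 2); first by rewrite mulr_ge0 ?sqr_ge0.
move=> h Hh; have hh := orbit_group_orth hG Hh.
(* As k fixes s, [k *m h] displaces s as h does; its distance to 1 is that of k to [h^T], hence
   controlled by the displacement of s. *)
have [k [Hk sk] kh] := dist _ (orbit_group_tr hG Hh).
have := quad _ (orbit_groupM hG Hk Hh); rewrite mulmxA sk => /le_trans; apply.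
rewrite -mulrA ler_wpM2l // -enorm_sqr -exprMn ler_pXn2r ?nnegrE //; last 2 first.
- exact: rnorm_ge0.
- by rewrite mulr_ge0 ?enorm_ge0 // ltW.
have -> : k *m h - 1%:M = (k - h^T) *m h by rewrite mulmxBl (mulmx1C hh).
rewrite rnorm_orth // rnormB; apply: le_trans kh _.
rewrite -(enorm_orth (_ - s) hh) mulmxBl -mulmxA (mulmx1C hh) mulmx1.
by rewrite enormB.
Qed.

Lemma aligned_nearby m (A : 'M[R]_(m, d)) s u : aligned_rows A ->
  (s <= A)%MS -> (u <= A)%MS -> exists2 e : R, 0 < e & aligned G s (s + e *: u).
Proof.
move=> aA sA uA; have [c c0 cP] := subspace_quad aA sA uA.
(* Moving s by g loses [q / 2] in the product with s and gains at most [e * c * q] in the product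
   with [e *: u]; this e makes [e * c <= 1 / 2]. *)
pose e := (2 * c + 1)^-1.
have c1 : 0 < 2 * c + 1 by rewrite ltr_wpDl // mulr_ge0.
have e0 : 0 < e by rewrite invr_gt0.
exists e => //; apply: (aligned_ge hG).
have [g Gg <-] := maxfilt_attained hG hclosed s (s + e *: u).
have := cP _ (sub_orbit_group Gg); rewrite ler_norml => /andP[_].
set q := dotp (s *m g - s) (s *m g - s) => le.
have q0 : 0 <= q by exact: dotp_ge0.
have qE : q = 2 * dotp s s - 2 * dotp (s *m g) s.
  by rewrite /q dotp_enormB dotp_orth ?(group_orth hG) //; ring.
have ec : e * c <= 2^-1.
  rewrite /e mulrC ler_pdivrMr // mulrDr mulrA mulVf // mul1r.
  by rewrite lerDl mulr_ge0 // invr_ge0.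
move: le; rewrite dotpBl !dotpDr !dotpZr => le.
have := ler_wpM2l (ltW e0) le; have := ler_wpM2r q0 ec.
rewrite mulrA; lra.
Qed.

Hypothesis Kpd : pos_def_kernel K.
Variable r : nat.
Hypothesis rmax : forall B : 'M[R]_(r.+1, d), row_free B -> ~ aligned_rows B.

(** Otherwise w could be added to the family, against maximality. *)
Lemma chamber_sub (A : 'M[R]_(r, d)) w :
  row_free A -> aligned_rows A -> chamber A w -> (w <= A)%MS.
Proof.
move=> fA aA cw; apply: contrapT => /negP wA.
by apply: (rmax (row_free_col_mx fA wA)); exact: aligned_rows_col_mx.
Qed.

(** The products of w with the rows are values of [K], so they depend only on its orbit; thus
    [w' - w] is orthogonal to the span in which it lies. *)
Lemma chamber_uniq (A : 'M[R]_(r, d)) w w' : row_free A -> aligned_rows A ->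
  chamber A w -> chamber A w' -> orbit G w w' -> w' = w.
Proof.
move=> fA aA cw cw' ww'; apply/eqP; rewrite -subr_eq0 -dotp_eq0.
have : (w' - w <= A)%MS by rewrite addmx_sub ?eqmx_opp ?chamber_sub.
case/submxP => a aE; rewrite {2}aE mulmx_sum_row dotp_sumr big1 // => i _.
rewrite dotpZr dotpBl cw cw' (maxfilt_orbit hG ww' (orbit_refl hG _)).
by rewrite subrr mulr0.
Qed.

Lemma chamber_meets m (A : 'M[R]_(m, d)) w :
  aligned_rows A -> exists2 g, G g & chamber A (w *m g).
Proof. by move=> aA; exact: align. Qed.

(** Align w' with w and all rows at once; the result is still in the chamber, so by uniqueness it is
    w'. *)
Lemma chamber_aligned (A : 'M[R]_(r, d)) w w' : row_free A -> aligned_rows A ->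
  chamber A w -> chamber A w' -> aligned G w w'.
Proof.
move=> fA aA cw cw'.
have [g Gg cg] := chamber_meets w' (aligned_rows_col_mx aA cw).
have cA : chamber A (w' *m g).
  by move=> i; have := cg (rshift 1 i); rewrite rowKd.
have := cg (lshift r 0); rewrite rowKu row_id.
by rewrite (chamber_uniq fA aA cw' cA (orbitM _ Gg)) => /(alignedC hG hclosed).
Qed.

Lemma chamber_row (A : 'M[R]_(r, d)) i : aligned_rows A -> chamber A (row i A).
Proof. by move=> aA j; exact: aA. Qed.

(** A single vector testing alignment with the whole family, by additivity of [K]. *)
Definition center m (A : 'M[R]_(m, d)) := \sum_i row i A.

Lemma center_aligned m (A : 'M[R]_(m, d)) w :
  aligned_rows A -> chamber A w <-> aligned G w (center A).
Proof.
by move=> aA; split; [exact: sum_aligned|exact: aligned_sum].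
Qed.

Lemma center_sub m (A : 'M[R]_(m, d)) : (center A <= A)%MS.
Proof. by apply: summx_sub => i _; exact: row_sub. Qed.

(* A chamber through s inside the row space of A: as long as the aligned rows of B
   do not span, moving slightly from s + center B gives one more independent row. *)
Lemma chamber_through (A : 'M[R]_(r, d)) s :
  row_free A -> aligned_rows A -> (s <= A)%MS ->
  exists B : 'M[R]_(r, d),
    [/\ row_free B, aligned_rows B, (B :=: A)%MS & chamber B s].
Proof.
move=> fA aA sA.
(* An independent family of r rows inside the span of [A] spans it. *)
suff [B [fB aB BA cB]] : exists B : 'M[R]_(r, d),
    [/\ row_free B, aligned_rows B, (B <= A)%MS & chamber B s].
  exists B; split=> //; apply/eqmxP; rewrite BA /=.
  by rewrite -(mxrank_leqif_sup BA) (eqP fA) (eqP fB).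
suff ex m : (m <= r)%N -> exists B : 'M[R]_(m, d),
  [/\ row_free B, aligned_rows B, (B <= A)%MS & chamber B s] by exact: ex.
elim: m => [_|m IH mr].
  exists 0; split; [by rewrite /row_free mxrank0|by case|exact: sub0mx|by case].
have [B [fB aB BA cB]] := IH (ltnW mr).
have ext w : ~~ (w <= B)%MS -> (w <= A)%MS -> chamber B w -> aligned G s w ->
    exists B : 'M[R]_(m.+1, d),
      [/\ row_free B, aligned_rows B, (B <= A)%MS & chamber B s].
  move=> wB wA cw sw; have wBA : (col_mx w B <= A)%MS by rewrite col_mx_sub wA.
  have sc : chamber (col_mx w B) s.
    move=> i; case: (split_ordP i) => l ->; rewrite ?rowKu ?rowKd; last exact: cB.
    by rewrite ord1 row_id.
  exists (col_mx w B); split.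
  - exact: row_free_col_mx.
  - exact: aligned_rows_col_mx.
  - exact: wBA.
  - exact: sc.
have [sB|sB] := boolP (s <= B)%MS; last first.
  by apply: (ext s) => //; exact: alignedxx.
have /row_subPn[i iB] : ~~ (A <= B)%MS.
  by apply: contraL mr => /mxrankS; rewrite (eqP fA) (eqP fB) -leqNgt.
have yA : ((s + center B)%R <= A)%MS.
  by rewrite addmx_sub // (submx_trans (center_sub B)).
have [e e0 al] := aligned_nearby aA yA (row_sub i A).
set w := _ + e *: _ in al.
have scB : aligned G s (center B) by apply/center_aligned.
(* [K w] is additive on the aligned pair, so equality for the sum forces equality for each term. *)
have split_al x y : aligned G x y -> aligned G w (x + y) -> aligned G w x /\ aligned G w y.
  move=> xy; rewrite /aligned maxfiltD // dotpDr.
  by have := dotp_le_maxfilt hG w x; have := dotp_le_maxfilt hG w y; split; lra.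
have [ws wc] := split_al _ _ scB (alignedC hG hclosed al).
apply: (ext w); last exact: alignedC.
- apply: contra iB => wB.
  have -> : row i A = e^-1 *: (w - (s + center B)).
    by rewrite /w addrC addKr scalerA mulVf ?gt_eqF // scale1r.
  by rewrite scalemx_sub // addmx_sub // eqmx_opp addmx_sub // center_sub.
- by rewrite addmx_sub // scalemx_sub // row_sub.
- by apply/center_aligned.
Qed.

(** Carry [center A] into the chamber of a family B through s with the same span. The rows of
    [A *m g] are then in that chamber too, hence in the span and aligned with s; transport by [g^T]
    brings s into the chamber of A. *)
Lemma section_fold (A : 'M[R]_(r, d)) s :
  row_free A -> aligned_rows A -> (s <= A)%MS ->
  exists g, [/\ G g, (A *m g <= A)%MS & chamber A (s *m g^T)].
Proof.
move=> fA aA sA; have [B [fB aB BA cs]] := chamber_through fA aA sA.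
have [g Gg cg] := chamber_meets (center A) aB.
have crow i : chamber B (row i A *m g).
  move=> j; apply: (alignedC hG hclosed).
  have /aligned_sum : forall i j, aligned G (row i A *m g) (row j A *m g).
    by move=> k l; apply: (aligned_orbit hG (sub_orbit_group Gg)); exact: aA.
  move=> /(_ hG hclosed Kpd (row j B)); apply.
  by rewrite -mulmx_suml; apply: alignedC => //; exact: cg.
exists g; split=> //.
  by apply/row_subP => i; rewrite row_mul -BA; exact: chamber_sub.
move=> i; have := chamber_aligned fB aB cs (crow i).
move/(aligned_orbit hG (orbit_group_tr hG (sub_orbit_group Gg))).
by rewrite -[in X in aligned _ _ X]mulmxA (group_orth hG) // mulmx1.
Qed.

End Chamber.

(** * Weyl group and quotient distance *)

Lemma inf_min (R : realType) (E : set R) (m : R) :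
  E m -> (forall z, E z -> m <= z) -> inf E = m.
Proof.
move=> Em mE; apply/eqP; rewrite eq_le; apply/andP; split.
  by apply: ge_inf => //; exists m.
by apply: lb_le_inf => //; exists m.
Qed.

Section Weyl.
Variables (R : realType) (d : nat) (G : set 'M[R]_d).
Hypothesis hG : orthogonal_subgroup G.
Variable S : 'M[R]_d.
Implicit Types (s t u x y : 'rV[R]_d) (g h w : 'M[R]_d).
Local Notation W := (weylW G S).

Lemma weylP w : W w <-> G w /\ (S *m w <= S)%MS.
Proof.
split=> -[Gw Ww]; split=> //.
  by apply/row_subP => i; rewrite row_mul; apply: Ww; exact: row_sub.
by move=> s sS; apply: submx_trans Ww; exact: submxMr.
Qed.

Lemma weyl_group w : W w -> G w. Proof. by case. Qed.

Lemma weyl_sub w s : W w -> (s <= S)%MS -> (s *m w <= S)%MS.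
Proof. by case=> _; apply. Qed.

Lemma weyl_orth w : W w -> w *m w^T = 1%:M.
Proof. by case=> Gw _; exact: (group_orth hG). Qed.

Lemma weyl1 : W 1%:M.
Proof. by split=> [|s]; [exact: group1|rewrite mulmx1]. Qed.

Lemma weylM w w' : W w -> W w' -> W (w *m w').
Proof.
move=> [Gw Ww] [Gw' Ww']; split=> [|s sS]; first exact: groupM.
by rewrite mulmxA; apply: Ww'; exact: Ww.
Qed.

Lemma weyl_tr w : W w -> W w^T.
Proof.
move=> /weylP[Gw Sw]; apply/weylP; split; first exact: group_tr.
have ww := group_orth hG Gw.
have uw : w \in unitmx by case: (mulmx1_unit ww).
(* w is invertible, so the inclusion of [S *m w] in S is an equality of ranks. *)
have /(submxMr w^T) : (S <= S *m w)%MS.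
  by rewrite -(mxrank_leqif_sup Sw) mxrankMfree // row_free_unit.
by rewrite -mulmxA ww mulmx1.
Qed.

End Weyl.

Section QuotientDistance.
Variables (R : realType) (d : nat) (G : set 'M[R]_d).
Hypothesis hG : orthogonal_subgroup G.
Hypothesis hclosed : closed_orbits G.
Implicit Types (s t u x y : 'rV[R]_d) (g h w : 'M[R]_d).

Lemma qdistE x y :
  qdist G x y = Num.sqrt (dotp x x + dotp y y - 2 * maxfilt G x y).
Proof.
apply: inf_min.
  have [g Gg <-] := maxfilt_attained hG hclosed x y.
  exists (x *m g); first exact: orbitM.
  exists y; first exact: orbit_refl.
  by rewrite /enorm dotp_enormB dotp_orth // (group_orth hG).
move=> _ [p xp [q yq <-]]; rewrite /enorm dotp_enormB ler_wsqrtr //.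
rewrite (orbit_norm hG xp) (orbit_norm hG yq).
by have := maxfilt_ge hG xp yq; lra.
Qed.

Lemma qdist_aligned x y : aligned G x y -> qdist G x y = enorm (x - y).
Proof. by move=> xy; rewrite qdistE -xy /enorm dotp_enormB. Qed.

Lemma qdist_orbit x y p q : orbit G x p -> orbit G y q -> qdist G p q = qdist G x y.
Proof. by move=> xp yq; rewrite /qdist (orbit_eq hG xp) (orbit_eq hG yq). Qed.

(** Polarisation: the quotient metric determines the kernel, so an isometric embedding of the
    quotient carries it along. *)
Lemma maxfilt_qdist x y :
  maxfilt G x y = (qdist G x 0 ^+ 2 + qdist G y 0 ^+ 2 - qdist G x y ^+ 2) / 2.
Proof.
have qn z : qdist G z 0 ^+ 2 = dotp z z.
  by rewrite qdistE maxfilt0 // dotp0l mulr0 addr0 subr0 sqr_sqrtr // dotp_ge0.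
rewrite !qn qdistE sqr_sqrtr; first by field.
have [g Gg <-] := maxfilt_attained hG hclosed x y.
have := dotp_ge0 (x *m g - y).
by rewrite dotp_enormB dotp_orth // (group_orth hG).
Qed.

Lemma qdistW_aligned S s t : aligned G s t -> qdistW G S s t = enorm (s - t).
Proof.
move=> st; apply: inf_min.
  have W1 := weyl1 hG S.
  by exists 1%:M => //; exists 1%:M => //; rewrite !mulmx1.
move=> _ [w [Gw _] [w' [Gw' _] <-]]; apply: le_enorm.
rewrite !dotp_enormB !dotp_orth ?(group_orth hG) // st.
by have := maxfilt_ge hG (orbitM s Gw) (orbitM t Gw'); lra.
Qed.

End QuotientDistance.

(** * Curves with a quadratic bound on one component of the displacement *)

Section Tangent.
Variables (R : realType) (d : nat).

(** The displacement is of order t, so its product with u is of order t^2 and has derivative 0 at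
    0. *)
Lemma quad_tangent (gam : R -> 'rV[R]_d) (v s u : 'rV[R]_d) (c : R) :
  gam 0 = s ->
  (forall i : 'I_d,
     is_derive (0 : R^o) (1 : R^o) (fun t : R^o => (gam t 0 i : R^o)) (v 0 i)) ->
  (forall t, `|dotp (gam t - s) u| <= c * dotp (gam t - s) (gam t - s)) ->
  dotp v u = 0.
Proof.
move=> gam0 D quad.
pose q (h : R) i := h^-1 * ((gam h - s) 0 i).
have cv i : q h i @[h --> 0^'] --> v 0 i.
  have [dv <-] := D i; rewrite /derivable in dv; apply: cvg_trans dv.
  apply: near_eq_cvg; near=> h; rewrite /q !mxE /= addr0.
  by rewrite -gam0 /GRing.scale /= mulr1.
have add_cont : continuous (fun z : R * R => z.1 + z.2).
  by move=> z; exact: add_continuous.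
have c1 : `|\sum_i q h i * u 0 i| @[h --> 0^'] --> `|\sum_i v 0 i * u 0 i|.
  apply: cvg_norm; apply: (cvg_big (x0 := 0) (P := predT) add_cont) => i _.
  by apply: cvgM; [exact: cv|exact: cvg_cst].
have c2 : c * (`|h| * \sum_i q h i * q h i) @[h --> (0 : R)^'] -->
    c * (`|0 : R| * \sum_i v 0 i * v 0 i).
  have n0 : `|h| @[h --> (0 : R)^'] --> `|0 : R|.
    by apply: cvg_norm; apply: cvg_within_filter; exact: cvg_id.
  have qq : \sum_i q h i * q h i @[h --> 0^'] --> \sum_i v 0 i * v 0 i.
    apply: (cvg_big (x0 := 0) (P := predT) add_cont) => i _.
    exact: (cvgM (cv i) (cv i)).
  have cc : c @[h --> (0 : R)^'] --> c by exact: cvg_cst.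
  have FF : Filter ((0 : R)^') by exact: dnbhs_filter.
  exact: (cvgM (FF := FF) cc (cvgM (FF := FF) n0 qq)).
have : `|\sum_i v 0 i * u 0 i| <= c * (`|0 : R| * \sum_i v 0 i * v 0 i).
  apply: ler_cvg_to c1 c2 _; near=> h.
  have h0 : h != 0 by near: h; exact: nbhs_dnbhs_neq.
  have -> : \sum_i q h i * u 0 i = h^-1 * dotp (gam h - s) u.
    by rewrite dotpE mulr_sumr; apply: eq_bigr => i _; rewrite mulrA.
  have -> : \sum_i q h i * q h i = h^-1 ^+ 2 * dotp (gam h - s) (gam h - s).
    by rewrite dotpE mulr_sumr; apply: eq_bigr => i _; rewrite mulrACA.
  rewrite normrM [X in _ <= c * X]mulrA.
  have -> : `|h| * h^-1 ^+ 2 = `|h^-1|.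
    rewrite -[h^-1 ^+ 2]real_normK ?num_real // normfV expr2 mulrA.
    by rewrite divff ?normr_eq0 // mul1r.
  by rewrite mulrCA ler_wpM2l.
by rewrite normr0 mul0r mulr0 normr_le0 -dotpE => /eqP.
Unshelve. all: by end_near.
Qed.

End Tangent.

(** * Hyperplane arrangements *)

Lemma seq_argmin (R : realType) (T : eqType) (f : T -> R) (s : seq T) x0 :
  x0 \in s -> exists2 x, x \in s & forall y, y \in s -> f x <= f y.
Proof.
elim: s x0 => [//|a s IH] x0 _; case: s IH => [_|b s IH].
  by exists a; rewrite ?mem_head // => y; rewrite inE => /eqP ->.
have [x xs xmin] := IH b (mem_head _ _).
have [le|lt] := leP (f x) (f a).
  exists x; first by rewrite inE xs orbT.
  by move=> y; rewrite inE => /predU1P[->//|/xmin].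
exists a; first exact: mem_head.
move=> y; rewrite inE => /predU1P[->//|/xmin]; exact: le_trans (ltW lt).
Qed.

Section Arrangement.
Variables (R : realType) (d : nat).
Implicit Types (p v n x : 'rV[R]_d) (P V : seq 'rV[R]_d).

Lemma perturb_pos P p v : (forall n, n \in P -> 0 < dotp p n) ->
  exists2 e, 0 < e & forall e', 0 < e' <= e -> forall n, n \in P -> 0 < dotp (p + e' *: v) n.
Proof.
elim: P => [_|a P IH pos]; first by exists 1.
have [|e e0 eP] := IH; first by move=> n nP; apply: pos; rewrite inE nP orbT.
have pa : 0 < dotp p a by apply: pos; exact: mem_head.
have va : 0 < `|dotp v a| + 1 by rewrite ltr_wpDl.
(* The summand 1 keeps the denominator positive when v is orthogonal to a. *)
exists (Order.min e (dotp p a / (`|dotp v a| + 1))).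
  by rewrite lt_min e0 divr_gt0.
move=> e' /andP[e'0]; rewrite le_min => /andP[e'e]; rewrite ler_pdivlMr // => e'a n.
rewrite inE => /predU1P[->|nP]; last by apply: eP => //; rewrite e'0.
rewrite dotpDl dotpZl; have := ler_wpM2l (ltW e'0) (ler_norm (- dotp v a)).
by rewrite normrN mulrN; move: e'a; rewrite mulrDr mulr1; lra.
Qed.

Lemma generic_vector (S : 'M[R]_d) V P p : (p <= S)%MS ->
  (forall n, n \in P -> 0 < dotp p n) -> (forall v, v \in V -> (v <= S)%MS) ->
  exists p', [/\ (p' <= S)%MS, forall n, n \in P -> 0 < dotp p' n &
    forall v, v \in V -> v != 0 -> dotp p' v != 0].
Proof.
elim: V P p => [|v V IH] P p pS pos VS; first by exists p.
have VS' u : u \in V -> (u <= S)%MS by move=> uV; apply: VS; rewrite inE uV orbT.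
have [->|v0] := eqVneq v 0.
  have [p' [p'S pos' gen]] := IH P p pS pos VS'.
  by exists p'; split=> // u; rewrite inE => /predU1P[->|]; [rewrite eqxx|exact: gen].
have [q [qS posq qv]] : exists q, [/\ (q <= S)%MS, forall n, n \in P -> 0 < dotp q n &
    dotp q v != 0].
  have [pv|pv] := eqVneq (dotp p v) 0; last by exists p.
  have [e e0 eP] := perturb_pos v pos; exists (p + e *: v); split.
  - by rewrite addmx_sub // scalemx_sub // VS // mem_head.
  - by apply: eP; rewrite e0 lexx.
  - by rewrite dotpDl pv add0r dotpZl mulf_neq0 ?gt_eqF ?dotp_gt0.
(* Nonvanishing on v is stored as positivity on [dotp q v *: v], an open condition that the later
   perturbations keep. *)
have [|p' [p'S pos' gen]] := IH ((dotp q v *: v) :: P) q qS _ VS'.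
  move=> n; rewrite inE => /predU1P[->|]; last exact: posq.
  by rewrite dotpZr -expr2 lt_neqAle sqr_ge0 andbT eq_sym sqrf_eq0.
exists p'; split=> //.
- by move=> n nP; apply: pos'; rewrite inE nP orbT.
- move=> u; rewrite inE => /predU1P[-> _|]; last exact: gen.
  by have := pos' _ (mem_head _ _); rewrite dotpZr; apply: contraTneq => ->; rewrite mulr0 ltxx.
Qed.

(* x is the first wall crossing on the segment from a generic point near p to v. *)
Lemma wall_crossing (S : 'M[R]_d) P p v n1 : (p <= S)%MS -> (v <= S)%MS ->
  (forall n, n \in P -> (n <= S)%MS) -> (forall n, n \in P -> 0 < dotp p n) ->
  n1 \in P -> dotp v n1 < 0 ->
  exists x n0, [/\ (x <= S)%MS, n0 \in P /\ dotp v n0 < 0, dotp x n0 = 0,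
    forall n, n \in P -> 0 <= dotp x n &
    forall n, n \in P -> dotp x n = 0 -> exists2 c, 0 < c & n = c *: n0].
Proof.
move=> pS vS PS pos n1P vn1.
(* If the segment meets the walls of a and b at the same point, its starting point is orthogonal to
   this combination; genericity then makes a and b proportional. *)
pose V := [seq dotp v b *: a - dotp v a *: b | a <- P, b <- P].
have VS u : u \in V -> (u <= S)%MS.
  move=> /allpairsP[[a b] /= [aP bP ->]].
  by rewrite addmx_sub ?eqmx_opp ?scalemx_sub ?PS.
have [q [qS posq gen]] := generic_vector pS pos VS.
(* The time at which the segment from q to v meets the hyperplane orthogonal to n. *)
pose tau n := dotp q n / (dotp q n - dotp v n).
have n1F : n1 \in [seq n <- P | dotp v n < 0] by rewrite mem_filter vn1.
have [n0] := seq_argmin tau n1F; rewrite mem_filter => /andP[vn0 n0P] tmin.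
pose t := tau n0; pose x := (1 - t) *: q + t *: v.
have D n : n \in P -> dotp v n < 0 -> 0 < dotp q n - dotp v n.
  by move=> nP vn; have := posq n nP; lra.
have xE n : dotp x n = dotp q n - t * (dotp q n - dotp v n).
  by rewrite /x dotpDl !dotpZl; ring.
have tn0 : t * (dotp q n0 - dotp v n0) = dotp q n0.
  by rewrite /t /tau divfK // gt_eqF // D.
have t0 : 0 < t by rewrite divr_gt0 ?D ?posq.
have t1 : t < 1 by rewrite ltr_pdivrMr ?D // mul1r; lra.
have xneg n : n \in P -> dotp v n < 0 -> 0 <= dotp x n.
  move=> nP vn; rewrite xE subr_ge0 -ler_pdivlMr ?D //; apply: tmin.
  by rewrite mem_filter vn.
have xpos n : n \in P -> 0 <= dotp v n -> 0 < dotp x n.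
  move=> nP vn; rewrite /x dotpDl !dotpZl ltr_pwDl //.
    by rewrite mulr_gt0 ?posq // subr_gt0.
  by rewrite mulr_ge0 // ltW.
exists x, n0; split=> //.
- by rewrite addmx_sub ?scalemx_sub.
- by rewrite xE tn0 subrr.
- move=> n nP; case: (ltP (dotp v n) 0) => vn; first exact: xneg.
  by rewrite ltW // xpos.
move=> n nP xn; case: (ltP (dotp v n) 0) => vn; last first.
  by have := xpos n nP vn; rewrite xn ltxx.
have xn0 : dotp x n0 = 0 by rewrite xE tn0 subrr.
have /eqP e0 : dotp v n0 *: n - dotp v n *: n0 == 0.
  apply: contraT => ne; have := gen _ _ ne.
  have uV : dotp v n0 *: n - dotp v n *: n0 \in V by apply/allpairsP; exists (n, n0).
  move=> /(_ uV) /negP[]; rewrite dotpBr !dotpZr; apply/eqP.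
  have t1' : 1 - t != 0 by rewrite subr_eq0 eq_sym lt_eqF.
  apply: (mulfI t1'); rewrite mulr0; move: xn xn0; rewrite /x !dotpDl !dotpZl.
  move=> /(congr1 (fun z => z * dotp v n0)) xn /(congr1 (fun z => z * dotp v n)) xn0.
  by move: xn xn0; rewrite !mul0r; lra.
exists (dotp v n / dotp v n0); first by rewrite nmulr_rgt0 // invr_lt0.
have /eqP := e0; rewrite subr_eq0 => /eqP e1.
by rewrite mulrC -scalerA -e1 scalerA mulVf ?lt_eqF // scale1r.
Qed.

End Arrangement.

(** * From a positive definite kernel to a reflection group *)

Lemma count_lt (T : eqType) (a b : pred T) (s : seq T) x :
  (forall y, a y -> b y) -> x \in s -> b x -> ~~ a x -> (count a s < count b s)%N.
Proof.
move=> ab xs bx ax; have := count_predC a [seq y <- s | b y].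
rewrite size_filter !count_filter => <-.
have -> : count (predI a b) s = count a s.
  by apply: eq_count => y /=; case ay: (a y) => //=; exact: ab.
rewrite -[X in (X < _)%N]addn0 ltn_add2l -has_count; apply/hasP.
by exists x => //=; rewrite ax bx.
Qed.

(** The number of listed values above [f t] drops at each ascent. *)
Lemma finite_ascent_ind (R : realType) (T : Type) (D Q : T -> Prop) (f : T -> R)
    (vals : seq R) :
  (forall t, D t -> f t \in vals) ->
  (forall t, D t -> (forall t', D t' -> f t < f t' -> Q t') -> Q t) ->
  forall t, D t -> Q t.
Proof.
move=> fvals step t Dt; pose m u := count (fun z => f u < z) vals.
have [k] := ubnP (m t); elim: k t Dt => // k IH t Dt; rewrite ltnS => mk.
apply: step => // t' Dt' lt; apply: IH => //; apply: leq_trans mk.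
apply: (count_lt _ (fvals t' Dt')) => //; last by rewrite ltxx.
by move=> y; exact: lt_trans.
Qed.

Section Forward.
Variables (R : realType) (d : nat) (G : set 'M[R]_d).
Hypothesis hG : orthogonal_subgroup G.
Hypothesis hclosed : closed_orbits G.
Hypothesis Kpd : pos_def_kernel (maxfilt G).
Variable r : nat.
Hypothesis rmax : forall B : 'M[R]_(r.+1, d), row_free B -> ~ aligned_rows G B.
Variable A : 'M[R]_(r, d).
Hypothesis fA : row_free A.
Hypothesis aA : aligned_rows G A.
Implicit Types (s t u x y : 'rV[R]_d) (g h w : 'M[R]_d).
Local Notation S := (<<A>>%MS).
Local Notation W := (weylW G S).
Local Notation p := (center A).

Lemma insubE s : insub_mx S s = (s <= A)%MS.
Proof. by rewrite /insub_mx genmxE. Qed.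

Lemma section_fold_weyl s : (s <= A)%MS -> exists2 w, W w & chamber G A (s *m w).
Proof.
move=> sA; have [g [Gg gA cg]] := section_fold hG hclosed Kpd rmax fA aA sA.
exists g^T => //; apply: weyl_tr => //; apply/weylP; split => //.
by rewrite genmxE; apply: submx_trans gA; apply: submxMr; rewrite genmxE.
Qed.

Lemma aligned_section : is_section G S.
Proof.
split=> [x|s sS v [gam [gam0 gamG gamD]] u uS].
  have [g Gg cg] := chamber_meets hG hclosed Kpd x aA.
  exists g^T; first exact: group_tr.
  exists (x *m g); last by rewrite -mulmxA (group_orth hG) // mulmx1.
  by rewrite insubE; apply: (chamber_sub hG hclosed rmax fA aA).
rewrite !insubE in sS uS.
have [c _ cP] := subspace_quad hG hclosed aA sS uS.
apply: quad_tangent gam0 gamD _ => t.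
by have [g Gg <-] := gamG t; apply: cP; exact: sub_orbit_group.
Qed.

Lemma aligned_isometric : quotients_isometric G S.
Proof.
(* The isometry picks the representative in the chamber. *)
have /choice[F FP] x : exists y, chamber G A y /\ orbit G x y.
  have [g Gg cg] := chamber_meets hG hclosed Kpd x aA.
  by exists (x *m g); split=> //; exact: orbitM.
exists F; split.
- by move=> x; rewrite insubE; apply: (chamber_sub hG hclosed rmax fA aA); case: (FP x).
- move=> x y yx; exists 1%:M; first exact: weyl1.
  have [cx xF] := FP x; have [cy yF] := FP y; rewrite mulmx1.
  apply: (chamber_uniq hG hclosed rmax fA aA cy cx).
  apply: (orbit_trans hG (orbit_sym hG yF)); exact: (orbit_trans hG yx).
- move=> x y; have [cx xF] := FP x; have [cy yF] := FP y.
  have al := chamber_aligned hG hclosed Kpd rmax fA aA cx cy.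
  by rewrite qdistW_aligned // -(qdist_orbit hG xF yF) qdist_aligned.
- move=> s; rewrite insubE => sA; have [w Ww cw] := section_fold_weyl sA.
  exists s, w => //; have [cs sF] := FP s.
  apply: (chamber_uniq hG hclosed rmax fA aA cw cs).
  apply: (orbit_trans hG _ sF); apply: (orbit_sym hG); apply: orbitM.
  by case: Ww.
Qed.

Lemma center_chamber : chamber G A p.
Proof. by apply/center_aligned => //; exact: alignedxx. Qed.

(** g maps each row of A to a vector aligned with [p], that is, to the only point of its orbit in
    the chamber. *)
Lemma fix_center g s : G g -> p *m g = p -> (s <= A)%MS -> s *m g = s.
Proof.
move=> Gg pg /submxP[a ->]; rewrite -mulmxA; congr (_ *m _).
apply/row_matrixP => i; rewrite row_mul.
apply: (chamber_uniq hG hclosed rmax fA aA (chamber_row i aA) _ (orbitM _ Gg)).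
apply/center_aligned => //; rewrite -pg.
apply: (aligned_orbit hG (sub_orbit_group Gg)).
by apply/center_aligned => //; exact: chamber_row.
Qed.

Lemma weyl_subA w s : W w -> (s <= A)%MS -> (s *m w <= A)%MS.
Proof. by move=> Ww sA; have := weyl_sub Ww (s := s); rewrite !genmxE; apply. Qed.

(** The displacement v of [p] lies in the span of A and its product with each row is [O(|v|^2)], so
    [|v|^2 = O(|v|^3)]; a short v must vanish. *)
Lemma center_orbit_discrete :
  exists2 c : R, 0 < c & forall w, W w -> enorm (p *m w - p) < c -> p *m w = p.
Proof.
have /choice[c cP] i : exists c : R, 0 <= c /\ forall h, orbit_group G h ->
    `|dotp (p *m h - p) (row i A)| <= c * dotp (p *m h - p) (p *m h - p).
  have [c c0 cP] := subspace_quad hG hclosed aA (center_sub A) (row_sub i A).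
  by exists c.
(* [pinvmx A] bounds the coordinates of v in the rows of A by its norm. *)
pose C := rnorm (pinvmx A) * \sum_i c i.
have C0 : 0 <= C.
  by rewrite mulr_ge0 ?rnorm_ge0 // sumr_ge0 // => i _; case: (cP i).
have C1 : 0 < C + 1 by rewrite ltr_wpDl.
exists (C + 1)^-1; first by rewrite invr_gt0.
move=> w Ww; set v := p *m w - p => vC.
have vA : (v <= A)%MS by rewrite addmx_sub ?eqmx_opp ?weyl_subA ?center_sub.
pose b := v *m pinvmx A.
have vE : v = \sum_i b 0 i *: row i A by rewrite -mulmx_sum_row mulmxKpV.
have le : dotp v v <= enorm v * C * dotp v v.
  rewrite {1}[in X in dotp _ X]vE dotp_sumr /C mulrA mulr_sumr mulr_suml.
  apply: ler_sum => i _; have [ci0 /(_ w (sub_orbit_group (weyl_group Ww)))] := cP i.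
  rewrite -/v => quad; rewrite dotpZr -[leRHS]mulrA.
  apply: le_trans (ler_norm _) _; rewrite normrM ler_pM //.
  exact: le_trans (coord_le_enorm _ _) (enormM _ _).
have [/eqP|v0] := eqVneq v 0; first by rewrite subr_eq0 => /eqP.
have {}le : 1 <= enorm v * C by rewrite -(ler_pM2r (x := dotp v v)) ?dotp_gt0 // mul1r.
exfalso; have := ler_wpM2r C0 (ltW vC).
have := mulVf (lt0r_neq0 C1); rewrite mulrDr mulr1.
have : 0 < (C + 1)^-1 by rewrite invr_gt0.
by move: le; lra.
Qed.

(** By [fix_center] the action of w on the section is determined by [p *m w]. Infinitely many such
    points on a sphere would accumulate, against discreteness. *)
Lemma weyl_finite : exists ws : seq 'M[R]_d, (forall w, w \in ws -> W w) /\
  forall w, W w -> exists2 w', w' \in ws & restr_eq S w w'.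
Proof.
apply: contrapT => N.
have /choice[nxt nxtP] (ws : seq 'M[R]_d) : exists w, (forall w, w \in ws -> W w) ->
    W w /\ forall w', w' \in ws -> p *m w <> p *m w'.
  have [Wws|nW] := pselect (forall w, w \in ws -> W w); last by exists 1%:M => /nW.
  apply: contrapT => Nw; apply: N; exists ws; split=> // w Ww.
  apply: contrapT => Nw'; apply: Nw; exists w => _; split=> // w' w'ws pE.
  apply: Nw'; exists w' => // s; rewrite insubE => sA.
  have ww' := weyl_orth hG (Wws _ w'ws).
  have := @fix_center (w *m w'^T) s _ _ sA.
  rewrite mulmxA pE -mulmxA ww' mulmx1.
  have Gww : G (w *m w'^T).
    by apply: groupM => //; [case: Ww|apply: group_tr => //; case: (Wws _ w'ws)].
  move=> /(_ Gww erefl) => sE.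
  by rewrite -{2}sE -!mulmxA (mulmx1C ww') mulmx1.
(* Iterating [nxt] gives a sequence in W with pairwise distinct images of [p]. *)
pose L n := iter n (fun l => nxt l :: l) [::]; pose f n := nxt (L n).
have WL n w : w \in L n -> W w.
  elim: n w => // n IH w; rewrite /L /= inE => /predU1P[->|/IH//].
  by have [] := nxtP _ IH.
have Wf n : W (f n) by have [] := nxtP _ (WL n).
have fL m n : (m < n)%N -> f m \in L n.
  elim: n => // n IH; rewrite ltnS leq_eqVlt /L /= inE => /predU1P[->|/IH ->].
    by rewrite eqxx.
  by rewrite orbT.
have finj m n : (m < n)%N -> p *m f n <> p *m f m.
  by move=> /fL mn; have [_ +] := nxtP _ (WL n); apply.
have [c c0 cP] := center_orbit_discrete.
have [U [UU tail]] := ultra_tail; have PU := @ultra_proper _ U UU.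
have [|l lP] := ultra_limit_mx UU (A := fun n => p *m f n) (M := enorm p).
  by move=> n; rewrite rnorm_row enorm_orth //; exact: (weyl_orth hG).
have c2 : 0 < c / 2 by rewrite divr_gt0.
have [m /= ml] := filter_ex (lP _ c2).
have [n /= [nl mn]] := filter_ex (filterI (lP _ c2) (tail m.+1)).
apply: (finj m n mn).
have ff := weyl_orth hG (Wf m).
have pE : p *m (f n *m (f m)^T) = p.
  apply: cP; first by apply: weylM => //; exact: weyl_tr.
  rewrite -(enorm_orth _ ff) mulmxBl -!mulmxA (mulmx1C ff) mulmx1.
  rewrite !rnorm_row in ml nl.
  have -> : p *m f n - p *m f m = (p *m f n - l) - (p *m f m - l).
    by rewrite opprB addrA subrK.
  by apply: le_lt_trans (enormD _ _) _; rewrite enormN; lra.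
by rewrite -{2}pE -!mulmxA (mulmx1C ff) mulmx1.
Qed.

(** The chamber contains the Dirichlet cell of [p] for W: folding x into the chamber by w realises
    [K x p] as a product of x with a point of the W-orbit of [p]. *)
Lemma chamber_weyl x : (x <= A)%MS ->
  (forall w, W w -> dotp x (p *m w) <= dotp x p) -> chamber G A x.
Proof.
move=> xA le; have [w Ww cw] := section_fold_weyl xA.
apply/center_aligned => //; apply: (aligned_ge hG).
rewrite -(maxfilt_orbit hG (orbitM x (weyl_group Ww)) (orbit_refl hG p)).
have <- : dotp (x *m w) p = maxfilt G (x *m w) p by apply/center_aligned.
by rewrite dotpMl; apply: le; exact: weyl_tr.
Qed.

(** The segment towards [p *m w] leaves the chamber at a point x of a single wall, with normal
    [n0 = p - p *m w0]. It turns out that w0 itself is the reflection across this wall. *)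
Lemma fold_reflection w : W w -> p *m w <> p ->
  exists rho a, [/\ W rho, insub_mx S a /\ a != 0,
    forall s, insub_mx S s -> s *m rho = reflect_across a s &
    dotp (p *m w) p < dotp (p *m w *m rho) p].
Proof.
move=> Ww pw; have [ws [Wws wsP]] := weyl_finite.
pose P := [seq p - p *m w' | w' <- ws & p *m w' != p].
have PP n : n \in P -> exists2 w', W w' & n = p - p *m w' /\ p *m w' != p.
  move=> /mapP[w']; rewrite mem_filter => /andP[pw' w'ws ->].
  by exists w' => //; exact: Wws.
have PA n : n \in P -> (n <= A)%MS.
  move=> /PP[w' Ww' [-> _]].
  by rewrite addmx_sub ?eqmx_opp ?weyl_subA ?center_sub.
have sqE n : n \in P -> dotp p n = dotp n n / 2.
  move=> /PP[w' Ww' [-> _]].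
  by rewrite dotp_enormB dotp_orth ?(weyl_orth hG Ww') // dotpBr; field.
have Pne n : n \in P -> 0 < dotp n n.
  by move=> /PP[w' _ [-> ne]]; rewrite dotp_gt0 subr_eq0 eq_sym.
have chP y : (y <= A)%MS -> (forall n, n \in P -> 0 <= dotp y n) -> chamber G A y.
  move=> yA yP; apply: chamber_weyl => // w0 Ww0.
  have [w' w'ws ->] : exists2 w', w' \in ws & p *m w0 = p *m w'.
    have [w' w'ws eqw] := wsP _ Ww0; exists w' => //; apply: eqw.
    by rewrite insubE center_sub.
  have [->//|ne] := eqVneq (p *m w') p.
  rewrite -subr_ge0 -dotpBr; apply: yP; apply/mapP; exists w' => //.
  by rewrite mem_filter ne.
have pwA : (p *m w <= A)%MS by rewrite weyl_subA ?center_sub.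
have [n1 n1P n1neg] : exists2 n1, n1 \in P & dotp (p *m w) n1 < 0.
  apply: contrapT => N; apply: pw.
  apply: (chamber_uniq hG hclosed rmax fA aA center_chamber); last first.
    by apply: orbitM; case: Ww.
  apply: chP => // n nP; rewrite leNgt; apply/negP => neg; apply: N.
  by exists n.
have PS n : n \in P -> (n <= S)%MS by rewrite genmxE; exact: PA.
have pS : (p <= S)%MS by rewrite genmxE center_sub.
have pwS : (p *m w <= S)%MS by rewrite genmxE.
have pos n : n \in P -> 0 < dotp p n.
  by move=> nP; rewrite sqE // divr_gt0 ?Pne.
have [x [n0 [xS [n0P neg] xn0 xP xtight]]] := wall_crossing pS pwS PS pos n1P n1neg.
rewrite genmxE in xS.
have [w0 Ww0 [n0E _]] := PP _ n0P; have w0w0 := weyl_orth hG Ww0.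
(* On the wall y has the same product with [p] and [p *m w0], so [y *m w0^T] is also in the chamber
   and equals y. *)
have fixch y : (y <= A)%MS -> chamber G A y -> dotp y n0 = 0 -> y *m w0 = y.
  move=> yA cy yn0; have Gw0 := weyl_group (weyl_tr hG Ww0).
  suff yE : y *m w0^T = y by rewrite -{1}yE -mulmxA (mulmx1C w0w0) mulmx1.
  apply: (chamber_uniq hG hclosed rmax fA aA cy _ (orbitM _ Gw0)).
  apply/center_aligned => //; rewrite /aligned dotpMl trmxK.
  rewrite (maxfilt_orbit hG (orbitM y Gw0) (orbit_refl hG p)).
  have /center_aligned <- // := cy.
  by apply/eqP; rewrite -subr_eq0 -opprB -dotpBr -n0E yn0 oppr0.
have fixx := fixch x xS (chP x xS xP) xn0.
(* All walls tight at x are proportional to n0, so a small step from x along the hyperplane stays in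
   the chamber; by linearity w0 fixes the direction y. *)
have fixy y : (y <= A)%MS -> dotp y n0 = 0 -> y *m w0 = y.
  move=> yA yn0; pose P' := [seq n <- P | 0 < dotp x n].
  have posx n : n \in P' -> 0 < dotp x n by rewrite mem_filter => /andP[].
  have [e e0 eP] := perturb_pos y posx.
  have xeA : ((x + e *: y)%R <= A)%MS by rewrite addmx_sub ?scalemx_sub.
  have xen0 : dotp (x + e *: y) n0 = 0 by rewrite dotpDl dotpZl xn0 yn0 mulr0 addr0.
  have := fixch _ xeA _ xen0.
  rewrite mulmxDl fixx -scalemxAl => /(_ _)/addrI fixe.
  suff cxe : chamber G A (x + e *: y).
    by have /(congr1 (fun z => e^-1 *: z)) := fixe cxe; rewrite !scalerA mulVf ?gt_eqF // !scale1r.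
  apply: chP => // n nP; have [xn|xn] := ltP 0 (dotp x n).
    by apply/ltW/eP; rewrite ?e0 ?lexx // mem_filter xn.
  have [|c _ ->] := xtight n nP; first by apply/eqP; rewrite eq_le xn xP.
  by rewrite dotpZr xen0 mulr0.
have n0A := PA _ n0P; have n0n0 := Pne _ n0P.
pose al s := dotp s n0 / dotp n0 n0; pose pr s := s - al s *: n0.
have prA s : (s <= A)%MS -> (pr s <= A)%MS.
  by move=> sA; rewrite addmx_sub ?eqmx_opp ?scalemx_sub.
have pr0 s : dotp (pr s) n0 = 0 by rewrite dotpBl dotpZl divfK ?subrr ?gt_eqF.
have decomp s : s = pr s + al s *: n0 by rewrite subrK.
have alp : al p = 2^-1 by rewrite /al sqE //; field; rewrite gt_eqF.
(* [p] is n0/2 plus a vector fixed by w0, while [p *m w0 = p - n0]. *)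
have n0w0 : n0 *m w0 = - n0.
  have pE : p = pr p + 2^-1 *: n0 by rewrite -alp -decomp.
  have : (pr p + 2^-1 *: n0) *m w0 = pr p + 2^-1 *: n0 - n0.
    by rewrite -pE n0E opprB addrC subrK.
  rewrite mulmxDl fixy ?prA ?center_sub // -[RHS]addrA => /addrI.
  rewrite -scalemxAl => /(congr1 (fun z => 2 *: z)) /=.
  by rewrite scalerBr !scalerA divff // !scale1r scaler_nat mulr2n opprD addrA subrr sub0r.
have refl s : (s <= A)%MS -> s *m w0 = reflect_across n0 s.
  move=> sA; rewrite {1}(decomp s) mulmxDl fixy ?prA // -scalemxAl n0w0 scalerN.
  rewrite /pr /reflect_across -addrA -opprD -scalerDl /al; congr (_ - _ *: _).
  by rewrite -mulrA; ring.
exists w0, n0; split=> //.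
- by rewrite insubE n0A -dotp_gt0.
- by move=> s; rewrite insubE; exact: refl.
rewrite refl // /reflect_across dotpBl dotpZl (dotpC n0) sqE //.
have -> : 2 * dotp (p *m w) n0 / dotp n0 n0 * (dotp n0 n0 / 2) = dotp (p *m w) n0.
  by field; rewrite gt_eqF.
by lra.
Qed.

Lemma aligned_reflection_group : finite_reflection_group_on G S.
Proof.
have [ws [Wws wsP]] := weyl_finite; split; first by exists ws.
pose is_refl w := exists2 a, insub_mx S a /\ a != 0 &
   forall s, insub_mx S s -> s *m w = reflect_across a s.
exists [seq w <- ws | `[< is_refl w >]]; split.
  by move=> w; rewrite mem_filter => /andP[/asboolP refl /Wws].
pose vals := [seq dotp (p *m w) p | w <- ws].
(* Each reflection from [fold_reflection] raises [dotp (p *m w) p], until [p] is fixed and w acts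
   trivially. *)
apply: (@finite_ascent_ind R _ W _ (fun w => dotp (p *m w) p) vals) => [w Ww|w Ww IH].
  have [w' w'ws ww'] := wsP w Ww; apply/mapP; exists w' => //.
  by rewrite ww' // insubE center_sub.
have [pw|pw] := pselect (p *m w = p).
  exists [::]; split=> // s; rewrite insubE => sA /=; rewrite mulmx1.
  by apply: fix_center => //; case: Ww.
have [rho [a [Wrho aS refl up]]] := fold_reflection Ww pw.
have [w' w'ws ww'] := wsP _ Wrho.
have [|rs [rsP rsE]] := IH _ (weylM hG Ww Wrho); first by rewrite mulmxA.
exists (rcons rs w'); split.
  move=> x; rewrite mem_rcons inE => /predU1P[->|/rsP//].
  rewrite mem_filter w'ws andbT; apply/asboolP; exists a => // s sS.
  by rewrite -ww' // refl.
move=> s sS; have -> : foldr (fun r m => r *m m) 1%:M (rcons rs w') =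
    foldr (fun r m => r *m m) 1%:M rs *m w'.
  elim: {rsP rsE} rs => [|g rs IHr] /=; first by rewrite mulmx1 mul1mx.
  by rewrite IHr mulmxA.
rewrite mulmxA -rsE // -ww'; last first.
  by exact: (weyl_sub (weylM hG Ww Wrho) sS).
have t0 : insub_mx S (s *m w) := weyl_sub Ww sS.
have t1 : insub_mx S (s *m w *m rho) := weyl_sub Wrho t0.
rewrite !mulmxA (refl _ t1) (refl _ t0).
rewrite /reflect_across; set t := s *m w.
have a0 : dotp a a != 0 by rewrite dotp_eq0; case: aS.
rewrite dotpBl dotpZl -addrA -opprD -scalerDl.
have -> : 2 * dotp t a / dotp a a + 2 * (dotp t a - 2 * dotp t a / dotp a a * dotp a a) / dotp a a = 0.
  by field.
by rewrite scale0r subr0.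
Qed.

End Forward.

Lemma max_aligned_family (R : realType) (d : nat) (G : set 'M[R]_d) :
  exists r (A : 'M[R]_(r, d)), [/\ row_free A, aligned_rows G A &
    forall B : 'M[R]_(r.+1, d), row_free B -> ~ aligned_rows G B].
Proof.
pose P m := `[< exists A : 'M[R]_(m, d), row_free A /\ aligned_rows G A >].
have exP : exists m, P m.
  by exists 0%N; apply/asboolP; exists 0; split; [rewrite /row_free mxrank0|case].
have ubP m : P m -> (m <= d)%N.
  by move=> /asboolP[A [/eqP fA _]]; rewrite -{1}fA rank_leq_col.
case: (ex_maxnP exP ubP) => r /asboolP[A [fA aA]] rP.
exists r, A; split=> // B fB aB.
have /rP : P r.+1 by apply/asboolP; exists B.
by rewrite ltnn.
Qed.

(** * Finite root systems *)

Section Reflections.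
Variables (R : realType) (d : nat).
Implicit Types (a b x y : 'rV[R]_d) (l : seq 'rV[R]_d).

Lemma refl_linear a (c : R) x y :
  reflect_across a (x + c *: y) = reflect_across a x + c *: reflect_across a y.
Proof.
rewrite /reflect_across dotpDl dotpZl scalerBr scalerA.
by apply/rowP => i; rewrite !mxE; ring.
Qed.

Lemma refl_self a : a != 0 -> reflect_across a a = - a.
Proof.
move=> a0; rewrite /reflect_across mulfK ?dotp_eq0 //.
by rewrite scaler_nat mulr2n opprD addrA subrr sub0r.
Qed.

Lemma reflZ (c : R) a x : c != 0 -> reflect_across (c *: a) x = reflect_across a x.
Proof.
move=> c0; have [->|a0] := eqVneq a 0; first by rewrite scaler0.
rewrite /reflect_across dotpZr !dotpZl !dotpZr scalerA; congr (_ - _ *: _).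
by field; rewrite ?c0 ?dotp_eq0 ?a0.
Qed.

Lemma refl_fix a x : dotp x a = 0 -> reflect_across a x = x.
Proof. by move=> xa; rewrite /reflect_across xa mulr0 mul0r scale0r subr0. Qed.

Lemma reflN a x : reflect_across (- a) x = reflect_across a x.
Proof. by rewrite -scaleN1r reflZ // oppr_eq0 oner_eq0. Qed.

Lemma refl_dot a x y : dotp (reflect_across a x) y = dotp x (reflect_across a y).
Proof.
by rewrite /reflect_across dotpBl dotpBr dotpZl dotpZr (dotpC a y); ring.
Qed.

Lemma reflK a : involutive (reflect_across a).
Proof.
move=> x; have [->|a0] := eqVneq a 0.
  by rewrite /reflect_across !scaler0 !subr0.
rewrite {2}/reflect_across -scaleNr refl_linear refl_self // scalerN scaleNr opprK.
by rewrite subrK.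
Qed.

Lemma refl_orth a x y : dotp (reflect_across a x) (reflect_across a y) = dotp x y.
Proof. by rewrite refl_dot reflK. Qed.

Lemma refl_conj a b x : reflect_across b (reflect_across a x) =
  reflect_across (reflect_across b a) (reflect_across b x).
Proof.
rewrite {2}/reflect_across -scaleNr refl_linear scaleNr.
by rewrite [in RHS]/reflect_across -/(reflect_across b a) -/(reflect_across b x) !refl_orth.
Qed.

Definition word_act x l := foldl (fun y a => reflect_across a y) x l.

Lemma word_act_cat x l1 l2 : word_act x (l1 ++ l2) = word_act (word_act x l1) l2.
Proof. exact: foldl_cat. Qed.

Lemma word_act_rcons x l a : word_act x (rcons l a) = reflect_across a (word_act x l).
Proof. by rewrite -cats1 word_act_cat. Qed.

Lemma word_act_orth x y l : dotp (word_act x l) (word_act y l) = dotp x y.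
Proof. by elim: l x y => //= a l IH x y; rewrite IH refl_orth. Qed.

End Reflections.

(** * Simple roots, words and chambers of a finite root system *)

Section RootSystem.
Variables (R : realType) (d : nat) (S : 'M[R]_d) (Phi : seq 'rV[R]_d) (rho : 'rV[R]_d).
Hypothesis PhiS : forall a, a \in Phi -> (a <= S)%MS.
Hypothesis Phi1 : forall a, a \in Phi -> dotp a a = 1.
Hypothesis PhiR : forall a b, a \in Phi -> b \in Phi -> reflect_across a b \in Phi.
Hypothesis rhoS : (rho <= S)%MS.
Hypothesis rho_reg : forall a, a \in Phi -> dotp rho a != 0.
Implicit Types (a b x y u v : 'rV[R]_d) (l : seq 'rV[R]_d).

Definition pos_root a := (a \in Phi) && (0 < dotp rho a).

(** Simplicity is encoded by the property that the exchange argument uses: the reflection keeps all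
    other positive roots positive. *)
Definition simple_root a :=
  pos_root a /\ forall b, pos_root b -> b != a -> pos_root (reflect_across a b).

Definition weyl_chamber x := forall a, pos_root a -> 0 <= dotp x a.

Lemma pos_rootN a : a \in Phi -> ~~ pos_root a -> pos_root (- a).
Proof.
move=> aP; rewrite /pos_root aP /= -leNgt dotpNr oppr_gt0 => le.
have a0 : a != 0 by rewrite -dotp_gt0 Phi1.
by rewrite -refl_self // PhiR //= lt_neqAle rho_reg.
Qed.

Lemma reflE a x : a \in Phi -> reflect_across a x = x - (2 * dotp x a) *: a.
Proof. by move=> aP; rewrite /reflect_across Phi1 // divr1. Qed.

(** The first wall a met from [rho] to v is simple: at the crossing point x all other positive roots
    are positive, and the reflection across a fixes x, so it cannot make them negative roots. *)
Lemma simple_crossing v b : (v <= S)%MS -> pos_root b -> dotp v b < 0 ->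
  exists2 a, simple_root a & dotp v a < 0.
Proof.
move=> vS pb vb; pose P := [seq a <- Phi | 0 < dotp rho a].
have PE a : (a \in P) = pos_root a by rewrite mem_filter andbC.
have [x [a [xS [aP va] xa xP xtight]]] : exists x n0,
    [/\ (x <= S)%MS, n0 \in P /\ dotp v n0 < 0, dotp x n0 = 0,
    forall n, n \in P -> 0 <= dotp x n &
    forall n, n \in P -> dotp x n = 0 -> exists2 c, 0 < c & n = c *: n0].
  apply: (wall_crossing (p := rho) (n1 := b)) => //; last by rewrite PE.
  - by move=> n; rewrite mem_filter => /andP[_ /PhiS].
  - by move=> n; rewrite mem_filter => /andP[].
have [aPhi apos] := andP (etrans (esym (PE a)) aP).
exists a => //; split; first by rewrite -PE.
move=> c pc ca; have [cPhi _] := andP pc.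
have xc : 0 < dotp x c.
  rewrite lt_neqAle eq_sym xP ?PE // andbT; apply: contra ca => /eqP xc0.
  have [|k k0 cE] := xtight c _ xc0; first by rewrite PE.
  have := Phi1 cPhi; rewrite cE dotpZl dotpZr Phi1 // mulr1 -expr2 => /eqP.
  by rewrite sqrp_eq1 ?(ltW k0) // => /eqP ->; rewrite scale1r.
apply: contraT => /(pos_rootN (PhiR aPhi cPhi)) neg.
have := xP (- reflect_across a c); rewrite PE => /(_ neg).
by rewrite dotpNr oppr_ge0 -refl_dot refl_fix // leNgt xc.
Qed.

Lemma simple_pos a : simple_root a -> pos_root a. Proof. by case. Qed.

Lemma pos_in a : pos_root a -> a \in Phi. Proof. by case/andP. Qed.

Lemma refl_simple_word b : pos_root b -> exists2 l, (forall a, a \in l -> simple_root a) &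
  forall x, reflect_across b x = word_act x l.
Proof.
move: b; apply: (@finite_ascent_ind R _ pos_root _ (fun b => - dotp rho b)
   [seq - dotp rho b | b <- Phi]) => [b /pos_in bP|b pb IH].
  by apply/mapP; exists b.
have [sb|nsb] := pselect (simple_root b).
  by exists [:: b] => // a; rewrite inE => /eqP ->.
have bP := pos_in pb.
(* Some simple a has a positive product with b; reflecting b across a lowers its product with [rho],
   and conjugating by a recovers the reflection across b. *)
have [||a sa ba] := simple_crossing (v := - b) _ pb.
- by rewrite eqmx_opp PhiS.
- by rewrite dotpNl Phi1 // oppr_lt0.
rewrite dotpNl oppr_lt0 in ba; have pa := simple_pos sa.
have ne : b != a by apply: contra_notN nsb => /eqP ->.
have [_ /(_ b pb ne) pb'] := sa.
have [|l sl lE] := IH _ pb'.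
  rewrite ltrN2 (reflE _ (pos_in pa)) dotpBr dotpZr.
  have [_ ra] := andP pa; have := mulr_gt0 ba ra; lra.
exists (a :: rcons l a).
  move=> c; rewrite inE mem_rcons inE => /predU1P[->//|/predU1P[->//|]]; exact: sl.
by move=> x /=; rewrite word_act_rcons -lE -refl_conj reflK.
Qed.

(* A simple word turning a positive root a negative meets a on its way, so one
   letter can be deleted from it at the price of the reflection across a. *)
Lemma exchange l a : (forall b, b \in l -> simple_root b) -> pos_root a ->
  ~~ pos_root (word_act a l) -> exists l', [/\ forall b, b \in l' -> simple_root b,
    (size l' < size l)%N & forall x, word_act (reflect_across a x) l = word_act x l'].
Proof.
elim: l a => [|b l IH] a sl pa /=; first by rewrite pa.
have sl' c : c \in l -> simple_root c by move=> cl; apply: sl; rewrite inE cl orbT.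
have sb : simple_root b by apply: sl; exact: mem_head.
have [->|ab] := eqVneq a b; first by exists l; split=> // x; rewrite reflK.
have [_ /(_ a pa ab) pa'] := sb.
move=> /(IH _ sl' pa')[l' [sl'' sz lE]].
exists (b :: l'); split=> //=.
  by move=> c; rewrite inE => /predU1P[->|/sl''].
by move=> x; rewrite refl_conj lE.
Qed.

Lemma weyl_chamber_uniq u l : (forall b, b \in l -> simple_root b) ->
  weyl_chamber u -> weyl_chamber (word_act u l) -> word_act u l = u.
Proof.
have [n] := ubnP (size l); elim: n l => // n IH [//|a l] /=; rewrite ltnS => ln sl cu cv.
have sl' c : c \in l -> simple_root c by move=> cl; apply: sl; rewrite inE cl orbT.
have sa : simple_root a by apply: sl; exact: mem_head.
have pa := simple_pos sa; have aP := pos_in pa.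
have a0 : a != 0 by rewrite -dotp_gt0 Phi1.
have [pal|nal] := boolP (pos_root (word_act a l)).
  have : dotp u a = 0.
    apply/eqP; rewrite eq_le cu // andbT.
    have := cv _ pal; rewrite word_act_orth refl_dot refl_self // dotpNr; lra.
  by move=> ua; move: cv; rewrite refl_fix //; apply: IH.
have [l' [sl'' sz lE]] := exchange sl' pa nal.
by move: cv; rewrite lE; apply: IH => //; exact: ltn_trans sz ln.
Qed.

End RootSystem.

(** * From a reflection group to a positive definite kernel *)

Section Backward.
Variables (R : realType) (d : nat) (G : set 'M[R]_d).
Hypothesis hG : orthogonal_subgroup G.
Variable S : 'M[R]_d.
Implicit Types (s t u x y a b : 'rV[R]_d) (g h w : 'M[R]_d).
Local Notation W := (weylW G S).

Lemma reflection_group_roots : finite_reflection_group_on G S ->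
  exists Phi : seq 'rV[R]_d, [/\ forall a, a \in Phi -> (a <= S)%MS,
    forall a, a \in Phi -> dotp a a = 1,
    forall a, a \in Phi -> exists2 w, W w &
      forall s, (s <= S)%MS -> s *m w = reflect_across a s,
    forall a w, a \in Phi -> W w -> a *m w \in Phi &
    forall w, W w -> exists2 l, (forall a, a \in l -> a \in Phi) &
      forall s, (s <= S)%MS -> s *m w = word_act s l].
Proof.
move=> [[ws [Wws wsP]] [refl [reflP genP]]].
have /choice[al alP] g : exists a, g \in refl -> [/\ W g, (a <= S)%MS, dotp a a = 1 &
    forall s, (s <= S)%MS -> s *m g = reflect_across a s].
  have [gr|gr] := boolP (g \in refl); last by exists 0.
  have [Wg [a [aS a0] aE]] := reflP g gr.
  have na : enorm a != 0 by rewrite enorm_eq0.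
  exists ((enorm a)^-1 *: a) => _; split=> //; first exact: scalemx_sub.
    by rewrite dotpZl dotpZr mulrA -expr2 -enorm_sqr -exprMn mulVf // expr1n.
  by move=> s sS; rewrite reflZ ?invr_eq0 // aE.
(* The W-images of the unit normals of the generators; the conjugate [w^T *m g *m w] reflects across
   [al g *m w]. *)
pose Phi := [seq al g *m w | g <- refl, w <- ws].
have PhiP a : a \in Phi -> exists g w, [/\ g \in refl, w \in ws & a = al g *m w].
  by move=> /allpairsP[[g w] /= [gr wws ->]]; exists g, w.
have mem g w : g \in refl -> W w -> al g *m w \in Phi.
  move=> gr Ww; have [w' w'ws eqw] := wsP w Ww; have [_ aS _ _] := alP g gr.
  by rewrite eqw //; apply/allpairsP; exists (g, w').
exists Phi; split.
- move=> _ /PhiP[g [w [gr wws ->]]]; have [_ aS _ _] := alP g gr.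
  by apply: weyl_sub aS; exact: Wws.
- move=> _ /PhiP[g [w [gr wws ->]]]; have [_ _ a1 _] := alP g gr.
  by rewrite dotp_orth // (weyl_orth hG (Wws _ wws)).
- move=> _ /PhiP[g [w [gr wws ->]]]; have [Wg aS a1 aE] := alP g gr.
  have Ww := Wws _ wws; have ww := weyl_orth hG Ww.
  exists (w^T *m g *m w).
    by apply: (weylM hG) => //; apply: (weylM hG) => //; exact: (weyl_tr hG).
  move=> s sS; rewrite !mulmxA aE; last exact: (weyl_sub (weyl_tr hG Ww)).
  rewrite /reflect_across dotp_orth // dotpMl trmxK mulmxBl -scalemxAl.
  by rewrite -mulmxA (mulmx1C ww) mulmx1.
- move=> _ w' /PhiP[g [w [gr wws ->]]] Ww'.
  by rewrite -mulmxA; apply: mem => //; apply: (weylM hG) => //; exact: Wws.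
- move=> w Ww; have [rs [rsP rsE]] := genP w Ww.
  suff [l lP lE] : exists2 l, (forall a, a \in l -> a \in Phi) &
      forall s, (s <= S)%MS ->
        s *m foldr (fun r m => r *m m) 1%:M rs = word_act s l.
    by exists l => // s sS; rewrite rsE // lE.
  elim: rs rsP {rsE} => [|g rs IH] rsP; first by exists [::] => // s _; rewrite mulmx1.
  have [l lP lE] : exists2 l, (forall a, a \in l -> a \in Phi) &
      forall s, (s <= S)%MS ->
        s *m foldr (fun r m => r *m m) 1%:M rs = word_act s l.
    by apply: IH => r rrs; apply: rsP; rewrite inE rrs orbT.
  have gr : g \in refl by apply: rsP; exact: mem_head.
  have [Wg aS _ aE] := alP g gr.
  exists (al g :: l).
    move=> a; rewrite inE => /predU1P[->|/lP//].
    by rewrite -[al g]mulmx1; apply: mem => //; exact: weyl1.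
  by move=> s sS /=; rewrite mulmxA (lE _ (weyl_sub Wg sS)) aE.
Qed.

(* phi picks the representative in a closed Weyl chamber. *)
Lemma reflection_group_fold : finite_reflection_group_on G S ->
  exists phi : 'rV[R]_d -> 'rV[R]_d, forall s t, (s <= S)%MS -> (t <= S)%MS ->
    qdistW G S s t = enorm (phi s - phi t).
Proof.
move=> fin; have [[ws [Wws wsP]] _] := fin.
have [Phi [PhiS Phi1 PhiW PhiM gen]] := reflection_group_roots fin.
have PhiR a b : a \in Phi -> b \in Phi -> reflect_across a b \in Phi.
  by move=> aP bP; have [w Ww wE] := PhiW a aP; rewrite -wE ?PhiS // PhiM.
have [rho [rhoS _ reg]] : exists p', [/\ (p' <= S)%MS,
    forall n, n \in ([::] : seq 'rV[R]_d) -> 0 < dotp p' n &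
    forall v, v \in Phi -> v != 0 -> dotp p' v != 0].
  by apply: (@generic_vector R d S Phi [::] 0) => //; exact: sub0mx.
have rho_reg a : a \in Phi -> dotp rho a != 0.
  by move=> aP; apply: reg => //; rewrite -dotp_gt0 Phi1.
pose C := weyl_chamber Phi rho.
have word w : W w -> exists2 l, (forall a, a \in l -> simple_root Phi rho a) &
    forall s, (s <= S)%MS -> s *m w = word_act s l.
  move=> Ww; have [l lP lE] := gen w Ww.
  have [l' sl' l'E] : exists2 l', (forall a, a \in l' -> simple_root Phi rho a) &
      forall x, word_act x l = word_act x l'.
    elim: {lE} l lP => [|a l IH] lP; first by exists [::].
    have [l' sl' l'E] : exists2 l', (forall a, a \in l' -> simple_root Phi rho a) &
        forall x, word_act x l = word_act x l'.
      by apply: IH => b bl; apply: lP; rewrite inE bl orbT.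
    have aP : a \in Phi by apply: lP; exact: mem_head.
    have [m sm mE] : exists2 m, (forall a, a \in m -> simple_root Phi rho a) &
        forall x, reflect_across a x = word_act x m.
      have [pa|na] := boolP (pos_root Phi rho a).
        exact: (refl_simple_word PhiS Phi1 PhiR rhoS rho_reg pa).
      have pa := pos_rootN Phi1 PhiR rho_reg aP na.
      have [m sm mE] := refl_simple_word PhiS Phi1 PhiR rhoS rho_reg pa.
      by exists m => // x; rewrite -mE reflN.
    exists (m ++ l').
      by move=> b; rewrite mem_cat => /orP[/sm|/sl'].
    by move=> x /=; rewrite word_act_cat -mE -l'E.
  by exists l' => // s sS; rewrite -l'E lE.
have uniq u w : (u <= S)%MS -> W w -> C u -> C (u *m w) -> u *m w = u.
  move=> uS Ww cu cw; have [l sl lE] := word w Ww.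
  by move: cw; rewrite lE // => cw; exact: (weyl_chamber_uniq Phi1 sl cu cw).
(* Reflecting across a positive root negative at y raises the product with [rho] and does not lower
   the product with any point of the chamber. *)
have fold y : (y <= S)%MS -> exists w, [/\ W w, C (y *m w) &
    forall t, C t -> dotp y t <= dotp (y *m w) t].
  move=> yS; pose D z := exists2 w, W w & z = y *m w.
  have Dy : D y by exists 1%:M; [exact: weyl1|rewrite mulmx1].
  suff ascend z : D z -> exists w, [/\ W w, C (z *m w) &
    forall t, C t -> dotp z t <= dotp (z *m w) t] by exact: ascend.
  move: z; apply: (@finite_ascent_ind R _ D _ (fun z => dotp z rho)
    [seq dotp (y *m w) rho | w <- ws]) => [_ [w Ww ->]|z [v Wv zE] IH].
    by have [w' w'ws eqw] := wsP w Ww; apply/mapP; exists w'; rewrite ?eqw.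
  have zS : (z <= S)%MS by rewrite zE; exact: (weyl_sub Wv).
  have [cz|ncz] := pselect (C z).
    by exists 1%:M; split; rewrite ?mulmx1 //; exact: weyl1.
  have [b pb zb] : exists2 b, pos_root Phi rho b & dotp z b < 0.
    apply: contrapT => N; apply: ncz => b pb; rewrite leNgt; apply/negP => zb.
    by apply: N; exists b.
  have [bP rb] := andP pb; have [g Wg gE] := PhiW b bP.
  have [||w [Ww cw le]] := IH (z *m g).
  - by exists (v *m g); [exact: (weylM hG)|rewrite zE mulmxA].
  - rewrite gE // (reflE Phi1 _ bP) dotpBl dotpZl (dotpC b).
    have : 0 < - dotp z b * dotp rho b by rewrite mulr_gt0 // oppr_gt0.
    by lra.
  exists (g *m w); split; [exact: (weylM hG)|by rewrite mulmxA|].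
  move=> t ct; rewrite mulmxA; apply: le_trans (le t ct).
  rewrite gE // (reflE Phi1 _ bP) dotpBl dotpZl (dotpC b).
  have : 0 <= - dotp z b * dotp t b by rewrite mulr_ge0 ?ct // oppr_ge0 ltW.
  by lra.
have /choice[phi phiP] s : exists c, (s <= S)%MS -> C c /\ exists2 w, W w & c = s *m w.
  have [sS|sS] := boolP (s <= S)%MS; last by exists 0.
  by have [w [Ww cw _]] := fold s sS; exists (s *m w) => _; split=> //; exists w.
exists phi => s t sS tS.
have [cs [a Wa sE]] := phiP s sS; have [ct [b Wb tE]] := phiP t tS.
have aa := weyl_orth hG Wa; have bb := weyl_orth hG Wb.
apply: inf_min; first by exists a => //; exists b; rewrite -?sE -?tE.
move=> _ [w Ww [w' Ww' <-]]; apply: le_enorm; rewrite !dotp_enormB.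
have ww := weyl_orth hG Ww; have ww' := weyl_orth hG Ww'.
rewrite !dotp_orth // {1 2}sE {1 2}tE !dotp_orth //.
suff : dotp (s *m w) (t *m w') <= dotp (phi s) (phi t) by lra.
(* Relative to the chamber representatives, the pair (w, w') amounts to g acting on [phi s]; folding
   [phi s *m g] back gives [phi s] by uniqueness. *)
pose g := a^T *m w *m w'^T *m b.
have Wg : W g.
  exact: (weylM hG (weylM hG (weylM hG (weyl_tr hG Wa) Ww) (weyl_tr hG Ww')) Wb).
have -> : dotp (s *m w) (t *m w') = dotp (phi s *m g) (phi t).
  rewrite tE sE /g !mulmxA dotp_orth // -[s *m a *m a^T]mulmxA aa mulmx1.
  by rewrite [RHS]dotpMl trmxK.
have phiS : (phi s <= S)%MS by rewrite sE; exact: (weyl_sub Wa).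
have [w3 [Ww3 c3 le]] := fold _ (weyl_sub Wg phiS).
apply: le_trans (le _ ct) _; rewrite -mulmxA in c3 *.
by rewrite (uniq _ _ phiS (weylM hG Wg Ww3) cs c3).
Qed.

End Backward.

Theorem theorem38 (R : realType) (d : nat) (G : set 'M[R]_d)
    (hG : orthogonal_subgroup G) (hclosed : closed_orbits G) :
  pos_def_kernel (maxfilt G) <->
  exists S : 'M[R]_d,
    [/\ is_section G S, quotients_isometric G S & finite_reflection_group_on G S].
Proof.
split=> [Kpd|[S [_ [F [FS _ Fdist _]] fin]]].
  have [r [A [fA aA rmax]]] := max_aligned_family G.
  exists <<A>>%MS; split.
  - exact: (aligned_section hG hclosed Kpd rmax fA aA).
  - exact: (aligned_isometric hG hclosed Kpd rmax fA aA).
  - exact: (aligned_reflection_group hG hclosed Kpd rmax fA aA).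
have [phi phiP] := reflection_group_fold hG fin.
split=> [x y|n xs c]; first exact: maxfiltC.
(* Translated so that the class of 0 goes to the origin, as polarisation requires. *)
pose v x := phi (F x) - phi (F 0).
have KE x y : maxfilt G x y = dotp (v x) (v y).
  rewrite maxfilt_qdist // -!Fdist !(phiP _ _ (FS _) (FS _)) !enorm_sqr -/(v x) -/(v y).
  have -> : phi (F x) - phi (F y) = v x - v y by rewrite opprB addrA subrK.
  by rewrite dotp_enormB; field.
have -> : \sum_(i < n) \sum_(j < n) c i * c j * maxfilt G (xs i) (xs j) =
    dotp (\sum_i c i *: v (xs i)) (\sum_i c i *: v (xs i)).
  rewrite dotp_suml; apply: eq_bigr => i _; rewrite dotp_sumr; apply: eq_bigr => j _.
  by rewrite KE dotpZl dotpZr mulrA.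
exact: dotp_ge0.
Qed.
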